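(* Let $(S,\theta)$ be an ID-simple ring with field of constants $C=C_S$. Suppose $S$ has a maximal ideal $\mathfrak m$ with $S/\mathfrak m\cong C$, i.e. the composite $C\hookrightarrow S\to S/\mathfrak m$ is an isomorphism. Then for every ID-module $M$ over $S$ there exists a Picard-Vessiot ring $R$ for $M$.
   Context: All rings are commutative with unit and nonzero; rings are not assumed Noetherian. An iterative derivation on a ring $R$ is a ring homomorphism $\theta:R\to R[[T]]$, written $\theta(r)=\sum_{i\ge 0}\theta^{(i)}(r)T^i$, with $\theta^{(0)}=\mathrm{id}_R$ and $\theta^{(i)}\circ\theta^{(j)}=\binom{i+j}{i}\theta^{(i+j)}$ for all $i,j\ge 0$; then $(R,\theta)$ is an ID-ring. Its ring of constants is $C_R=\{r\in R\mid \theta(r)=r\}$. An ideal $I$ of $R$ is an ID-ideal if $\theta(I)\subseteq I[[T]]$; $R$ is ID-simple if its only ID-ideals are $\{0\}$ and $R$ (the constants of an ID-simple ring form a field). A homomorphism of ID-rings is a ring homomorphism commuting with all $\theta^{(n)}$. An ID-module $(M,\theta_M)$ over an ID-ring $R$ is a finitely generated $R$-module $M$ with an additive map $\theta_M:M\to M[[T]]$, $\theta_M(m)=\sum_i\theta_M^{(i)}(m)T^i$, such that $\theta_M(rm)=\theta(r)\theta_M(m)$, $\theta_M^{(0)}=\mathrm{id}_M$, $\theta_M^{(i)}\circ\theta_M^{(j)}=\binom{i+j}{i}\theta_M^{(i+j)}$. An ID-module is trivial if it has a finite $R$-basis consisting of constant elements ($\theta_M(m)=m$). Tensor products carry $\theta^{(k)}(a\otimes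 b)=\sum_{i+j=k}\theta^{(i)}(a)\otimes\theta^{(j)}(b)$. Let $M$ be an ID-module over the ID-simple ring $S$ with constants $C$. A solution ring for $M$ is an ID-simple ring $R$ with a homomorphism of ID-rings $f:S\to R$ (automatically injective) such that $C_R=f(C)$ and $R\otimes_S M$ is a trivial ID-module over $R$. A Picard-Vessiot ring for $M$ is a solution ring $(R,f)$ that is minimal: for every solution ring $(\tilde R,\tilde f)$ for $M$, every ID-homomorphism $g:\tilde R\to R$ with $g\circ\tilde f=f$ is an isomorphism. *)

(* Defs.v *)
From HB Require Import structures.
From mathcomp Require Import all_boot all_order all_algebra.
From mathcomp Require Import boolp.

Set Implicit Arguments.
Unset Strict Implicit.
Unset Printing Implicit Defensive.

Import GRing.Theory.
Local Open Scope ring_scope.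
Local Open Scope quotient_scope.

(* [theta n r] is the coefficient of T^n in theta(r).  The laws [thetaD],
   [theta1] and [thetaM] say, coefficientwise, that theta : R -> R[[T]] is a
   ring homomorphism. *)
HB.mixin Record isIDRing R of GRing.ComNzRing R := {
  theta : nat -> R -> R;
  thetaD : forall n a b, theta n (a + b) = theta n a + theta n b;
  theta1 : forall n, theta n 1 = (n == 0%N)%:R;
  thetaM : forall n a b,
    theta n (a * b) = \sum_(i < n.+1) theta i a * theta (n - i)%N b;
  theta0 : forall a, theta 0%N a = a;
  theta_comp : forall i j a,
    theta i (theta j a) = theta (i + j)%N a *+ 'C(i + j, i)
}.

#[short(type="idRingType")]
HB.structure Definition IDRing := {R of isIDRing R & GRing.ComNzRing R}.

Definition ID_constant (R : idRingType) (r : R) : Prop :=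
  forall n, theta n r = if n == 0%N then r else 0.

(* MathComp's [idealr R] is the type of proper ideals of [R]; they are given by
   boolean predicates, which is no restriction in classical logic. *)
Definition ID_ideal (R : idRingType) (I : idealr R) : Prop :=
  forall n r, r \in I -> theta n r \in I.

Definition ID_simple (R : idRingType) : Prop :=
  forall I : idealr R, ID_ideal I -> forall r, r \in I -> r = 0.

Definition maximal_ideal (R : comNzRingType) (I : idealr R) : Prop :=
  forall J : idealr R, {subset I <= J} -> {subset J <= I}.

HB.mixin Record isIDMorphism (S R : idRingType) (f : S -> R) := {
  theta_morph : forall n s, f (theta n s) = theta n (f s)
}.

#[short(type="idMorphism")]
HB.structure Definition IDMorphism (S R : idRingType) :=
  {f of @GRing.RMorphism S R f & isIDMorphism S R f}.

HB.mixin Record isIDModule (R : idRingType) M of GRing.Lmodule R M := {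
  finitely_generated : exists (n : nat) (g : 'I_n -> M),
    forall m, exists c : 'I_n -> R, m = \sum_(i < n) c i *: g i;
  mtheta : nat -> M -> M;
  mthetaD : forall n u v, mtheta n (u + v) = mtheta n u + mtheta n v;
  mthetaZ : forall n r m,
    mtheta n (r *: m) = \sum_(i < n.+1) theta i r *: mtheta (n - i)%N m;
  mtheta0 : forall m, mtheta 0%N m = m;
  mtheta_comp : forall i j m,
    mtheta i (mtheta j m) = mtheta (i + j)%N m *+ 'C(i + j, i)
}.

#[short(type="idModType")]
HB.structure Definition IDModule (R : idRingType) :=
  {M of isIDModule R M & GRing.Lmodule R M}.

Definition ID_mconstant (R : idRingType) (M : idModType R) (m : M) : Prop :=
  forall n, mtheta n m = if n == 0%N then m else 0.

Definition ID_trivial (R : idRingType) (M : idModType R) : Prop :=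
  exists (n : nat) (e : 'I_n -> M),
    (forall m, exists! c : {ffun 'I_n -> R}, m = \sum_(i < n) c i *: e i) /\
    (forall i, ID_mconstant (e i)).

(* The tensor product R (x)_S M, for R an S-algebra via f: formal sums of pure
   tensors, modulo the congruence generated by the usual relations. *)
Section Tensor.
Variables (S R : comNzRingType) (f : {rmorphism S -> R}) (M : lmodType S).
Implicit Types (s t u : seq (R * M)) (a b : R) (m : M).

Inductive teq : seq (R * M) -> seq (R * M) -> Prop :=
| teq_refl s : teq s s
| teq_sym s t : teq s t -> teq t s
| teq_trans s t u : teq s t -> teq t u -> teq s u
| teq_cat s s' t t' : teq s s' -> teq t t' -> teq (s ++ t) (s' ++ t')
| teq_catC s t : teq (s ++ t) (t ++ s)
| teq_zero m : teq [:: (0, m)] [::]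
| teq_addl a b m : teq [:: (a + b, m)] [:: (a, m); (b, m)]
| teq_addr a m m' : teq [:: (a, m + m')] [:: (a, m); (a, m')]
| teq_scale a c m : teq [:: (a * f c, m)] [:: (a, c *: m)].

Definition teqb s t : bool := `[< teq s t >].

Lemma teqb_equiv : equiv_class_of teqb.
Proof.
split=> [s|s t|t s u].
- exact/asboolP/teq_refl.
- by apply/idP/idP => /asboolP h; apply/asboolP/teq_sym.
- by move=> /asboolP h1 /asboolP h2; apply/asboolP/(teq_trans h1 h2).
Qed.

Canonical teq_equiv := EquivRelPack teqb_equiv.

Definition tensor := {eq_quot teq_equiv}.
HB.instance Definition _ := Choice.on tensor.
HB.instance Definition _ := EqQuotient.on tensor.

Definition tclass s : tensor := \pi_tensor s.

Definition pure a m : tensor := tclass [:: (a, m)].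

Lemma tclassP s t : tclass s = tclass t <-> teq s t.
Proof.
rewrite /tclass; split=> [/eqP|h]; last apply/eqP.
  by rewrite eqmodE => /asboolP.
by rewrite eqmodE; exact/asboolP.
Qed.

Lemma tensor_ind (x : tensor) : exists s, x = tclass s.
Proof. by exists (repr x); rewrite /tclass reprK. Qed.

Lemma repr_tclass s : teq (repr (tclass s)) s.
Proof. by apply/tclassP; rewrite /tclass reprK. Qed.

Definition tadd (x y : tensor) : tensor := tclass (repr x ++ repr y).

Definition tmap (phi : R -> R) s := [seq (phi x.1, x.2) | x <- s].

Definition topp (x : tensor) : tensor := tclass (tmap -%R (repr x)).

Definition tscale a (x : tensor) : tensor := tclass (tmap ( *%R a) (repr x)).

Lemma taddE s t : tadd (tclass s) (tclass t) = tclass (s ++ t).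
Proof. by apply/tclassP/teq_cat; apply: repr_tclass. Qed.

Lemma teq_tmap (phi : R -> R) : phi 0 = 0 -> {morph phi : a b / a + b} ->
  (forall a b, phi (a * b) = phi a * b) ->
  forall s t, teq s t -> teq (tmap phi s) (tmap phi t).
Proof.
move=> p0 pD pM s t; elim=> {s t} /=.
- by move=> s; exact: teq_refl.
- by move=> s t _; exact: teq_sym.
- by move=> s t u _ h1 _; exact: teq_trans.
- by move=> s s' t t' _ h1 _ h2; rewrite /tmap !map_cat; exact: teq_cat.
- by move=> s t; rewrite /tmap !map_cat; exact: teq_catC.
- by move=> m; rewrite p0; exact: teq_zero.
- by move=> a b m; rewrite pD; exact: teq_addl.
- by move=> a m m'; exact: teq_addr.
- by move=> a c m; rewrite pM; exact: teq_scale.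
Qed.

Lemma toppE s : topp (tclass s) = tclass (tmap -%R s).
Proof.
apply/tclassP/teq_tmap; last exact: repr_tclass.
- exact: oppr0.
- exact: opprD.
- by move=> a b; rewrite mulNr.
Qed.

Lemma tscaleE a s : tscale a (tclass s) = tclass (tmap ( *%R a) s).
Proof.
apply/tclassP/teq_tmap; last exact: repr_tclass.
- exact: mulr0.
- exact: mulrDr.
- by move=> b c; rewrite mulrA.
Qed.

Lemma taddA : associative tadd.
Proof.
move=> x y z; have [s ->] := tensor_ind x; have [t ->] := tensor_ind y.
by have [u ->] := tensor_ind z; rewrite !taddE catA.
Qed.

Lemma taddC : commutative tadd.
Proof.
move=> x y; have [s ->] := tensor_ind x; have [t ->] := tensor_ind y.
by rewrite !taddE; apply/tclassP/teq_catC.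
Qed.

Lemma tadd0 : left_id (tclass [::]) tadd.
Proof. by move=> x; have [s ->] := tensor_ind x; rewrite taddE. Qed.

Lemma tclass_cons x s : tclass (x :: s) = tadd (pure x.1 x.2) (tclass s).
Proof. by rewrite taddE; case: x. Qed.

Lemma pureDl a b m : pure (a + b) m = tadd (pure a m) (pure b m).
Proof. by rewrite taddE; apply/tclassP/teq_addl. Qed.

Lemma pure0l m : pure 0 m = tclass [::].
Proof. exact/tclassP/teq_zero. Qed.

Lemma taddN : left_inverse (tclass [::]) topp tadd.
Proof.
move=> x; have [s ->] := tensor_ind x; rewrite toppE.
elim: s => [|[a m] s IH] /=; first by rewrite tadd0.
rewrite !tclass_cons -taddA [X in tadd _ X]taddA [X in tadd X (tclass s)]taddC.
by rewrite -taddA taddA IH -pureDl addNr pure0l tadd0.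
Qed.

HB.instance Definition _ :=
  GRing.isZmodule.Build tensor taddA taddC tadd0 taddN.

Lemma tscaleA a b (x : tensor) : tscale a (tscale b x) = tscale (a * b) x.
Proof.
have [s ->] := tensor_ind x; rewrite !tscaleE /tmap -map_comp.
by congr tclass; apply: eq_map => y /=; rewrite mulrA.
Qed.

Lemma tscale1 : left_id 1 tscale.
Proof.
move=> x; have [s ->] := tensor_ind x; rewrite tscaleE; congr tclass.
by rewrite -[RHS]map_id; apply: eq_map => -[b m] /=; rewrite mul1r.
Qed.

Lemma tscaleDr : right_distributive tscale +%R.
Proof.
move=> a x y; have [s ->] := tensor_ind x; have [t ->] := tensor_ind y.
by rewrite /GRing.add /= taddE !tscaleE taddE /tmap map_cat.
Qed.

Lemma tscaleDl (x : tensor) : {morph tscale^~ x : a b / a + b}.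
Proof.
move=> a b; have [s ->] := tensor_ind x; rewrite !tscaleE.
elim: s => [|[c m] s IH] /=; first by rewrite -[LHS]addr0.
rewrite !tclass_cons /= IH mulrDl pureDl -!/(_ + _).
exact: addrACA.
Qed.

HB.instance Definition _ := GRing.Zmodule_isLmodule.Build R tensor
  tscaleA tscale1 tscaleDr tscaleDl.

Lemma pure_sum s : tclass s = \sum_(x <- s) pure x.1 x.2.
Proof.
by elim: s => [|x s IH]; rewrite ?big_nil // big_cons -IH tclass_cons.
Qed.

Lemma pureD a b m : pure (a + b) m = pure a m + pure b m.
Proof. exact: pureDl. Qed.

Lemma pureDr a m m' : pure a (m + m') = pure a m + pure a m'.
Proof.
by rewrite /GRing.add /= taddE; apply/tclassP/teq_addr.
Qed.

Lemma pureZ a b m : a *: pure b m = pure (a * b) m.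
Proof. exact: tscaleE. Qed.

Lemma pureM a c m : pure (a * f c) m = pure a (c *: m).
Proof. exact/tclassP/teq_scale. Qed.

Lemma pure0 m : pure 0 m = 0.
Proof. exact: pure0l. Qed.

Lemma pure0r a : pure a 0 = 0.
Proof. by apply: (addIr (pure a 0)); rewrite -pureDr !add0r. Qed.

Lemma pure_suml (I : Type) (r : seq I) (F : I -> R) m :
  pure (\sum_(i <- r) F i) m = \sum_(i <- r) pure (F i) m.
Proof. exact: (big_morph (pure^~ m) (fun a b => pureD a b m) (pure0 m)). Qed.

Lemma pure_sumr (I : Type) (r : seq I) a (F : I -> M) :
  pure a (\sum_(i <- r) F i) = \sum_(i <- r) pure a (F i).
Proof. exact: (big_morph (pure a) (pureDr a) (pure0r a)). Qed.

Lemma pureMnl a m n : pure (a *+ n) m = pure a m *+ n.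
Proof. by elim: n => [|n IH]; rewrite ?pure0 // !mulrS pureD IH. Qed.

Lemma pureMnr a m n : pure a (m *+ n) = pure a m *+ n.
Proof. by elim: n => [|n IH]; rewrite ?pure0r // !mulrS pureDr IH. Qed.

End Tensor.

Arguments tensor {S R} f M.
Arguments pure {S R} f {M}.

(* Both sides are the sum of the F i j l over i + j + l = n. *)
Lemma sum_triangle (V : nmodType) n (F : nat -> nat -> nat -> V) :
  \sum_(k < n.+1) \sum_(i < k.+1) F i (k - i)%N (n - k)%N =
  \sum_(i < n.+1) \sum_(j < (n - i).+1) F i j (n - i - j)%N.
Proof.
transitivity (\sum_(0 <= k < n.+1) \sum_(0 <= i < n.+1 | (i <= k)%N)
                F i (k - i)%N (n - k)%N).
  rewrite big_mkord; apply: eq_bigr => k _; rewrite big_mkord.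
  by rewrite (big_ord_widen_cond _ predT (fun i => F i (k - i)%N (n - k)%N)
    (ltn_ord k)).
rewrite (exchange_big_dep_nat predT) //= big_mkord; apply: eq_bigr => i _.
rewrite (big_cat_nat (n := i)) //=; last by rewrite ltnW.
rewrite big1_seq ?add0r; last first.
  by move=> k; rewrite mem_index_iota /= => /andP[ik]; rewrite ltnNge ik.
rewrite -{1}[i : nat]add0n big_addn big_mkord -subSn; last by rewrite -ltnS.
apply: eq_big => j; first by rewrite leq_addl.
by rewrite addnK subnDA subnAC.
Qed.

Section TensorTheta.
Variables (S R : idRingType) (f : idMorphism S R) (M : idModType S).
Local Notation N := (tensor f M).
Implicit Types (s t : seq (R * M)) (x y : N).

Lemma theta_0 (A : idRingType) n : theta n (0 : A) = 0.
Proof. by apply: (addIr (theta n 0)); rewrite -thetaD !add0r. Qed.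

Lemma mtheta_0 n : mtheta n (0 : M) = 0.
Proof. by apply: (addIr (mtheta n 0)); rewrite -mthetaD !add0r. Qed.

Definition tpure k (a : R) (m : M) : N :=
  \sum_(i < k.+1) pure f (theta i a) (mtheta (k - i)%N m).

Definition ttheta_seq k s : N := \sum_(x <- s) tpure k x.1 x.2.

Definition ttheta k (x : N) : N := ttheta_seq k (repr x).

Lemma tpureM k a c m : tpure k (a * f c) m = tpure k a (c *: m).
Proof.
rewrite /tpure.
transitivity (\sum_(i < k.+1) \sum_(p < i.+1)
    pure f (theta p a) (theta (i - p)%N c *: mtheta (k - i)%N m)).
  apply: eq_bigr => i _; rewrite thetaM pure_suml; apply: eq_bigr => p _.
  by rewrite -theta_morph pureM.
rewrite (sum_triangle k
  (fun p q l => pure f (theta p a) (theta q c *: mtheta l m))).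
by apply: eq_bigr => i _; rewrite mthetaZ pure_sumr.
Qed.

Lemma ttheta_seqP k s t : teq f s t -> ttheta_seq k s = ttheta_seq k t.
Proof.
rewrite /ttheta_seq; elim=> {s t} //=.
- by move=> s t u _ -> _ ->.
- by move=> s s' t t' _ h1 _ h2; rewrite !big_cat /= h1 h2.
- by move=> s t; rewrite !big_cat /= addrC.
- move=> m; rewrite big_seq1 big_nil /tpure big1 // => i _.
  by rewrite theta_0 pure0.
- move=> a b m; rewrite !big_cons big_nil !addr0 -big_split /=.
  by apply: eq_bigr => i _; rewrite thetaD pureD.
- move=> a m m'; rewrite !big_cons big_nil !addr0 -big_split /=.
  by apply: eq_bigr => i _; rewrite mthetaD pureDr.
- by move=> a c m; rewrite !big_seq1 tpureM.
Qed.

Lemma tthetaE k s : ttheta k (tclass f s) = ttheta_seq k s.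
Proof. exact/ttheta_seqP/repr_tclass. Qed.

Lemma ttheta_pure k a m : ttheta k (pure f a m) =
  \sum_(i < k.+1) pure f (theta i a) (mtheta (k - i)%N m).
Proof. by rewrite tthetaE /ttheta_seq big_seq1. Qed.

Lemma tthetaD k x y : ttheta k (x + y) = ttheta k x + ttheta k y.
Proof.
have [s ->] := tensor_ind x; have [t ->] := tensor_ind y.
by rewrite {1}/GRing.add /= taddE !tthetaE /ttheta_seq big_cat.
Qed.

Lemma ttheta_0 k : ttheta k 0 = 0.
Proof. by apply: (addIr (ttheta k 0)); rewrite -tthetaD !add0r. Qed.

Lemma ttheta_sum k (I : Type) (r : seq I) (F : I -> N) :
  ttheta k (\sum_(i <- r) F i) = \sum_(i <- r) ttheta k (F i).
Proof. exact: (big_morph (ttheta k) (tthetaD k) (ttheta_0 k)). Qed.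

Lemma ttheta_ind (P : N -> Prop) : P 0 ->
  (forall x y, P x -> P y -> P (x + y)) -> (forall a m, P (pure f a m)) ->
  forall x, P x.
Proof.
move=> P0 PD Pp x; have [s ->] := tensor_ind x; rewrite pure_sum.
by elim/big_ind: _.
Qed.

Lemma tthetaZ k r x :
  ttheta k (r *: x) = \sum_(i < k.+1) theta i r *: ttheta (k - i)%N x.
Proof.
elim/ttheta_ind: x => [|x y IHx IHy|a m].
- rewrite scaler0 ttheta_0 big1 // => i _.
  by rewrite ttheta_0 scaler0.
- rewrite scalerDr tthetaD IHx IHy -big_split /=.
  by apply: eq_bigr => i _; rewrite tthetaD scalerDr.
- rewrite pureZ ttheta_pure.
  transitivity (\sum_(i < k.+1) \sum_(p < i.+1)
     pure f (theta p r * theta (i - p)%N a) (mtheta (k - i)%N m)).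
    by apply: eq_bigr => i _; rewrite thetaM pure_suml.
  rewrite (sum_triangle k
    (fun p q l => pure f (theta p r * theta q a) (mtheta l m))).
  apply: eq_bigr => i _; rewrite ttheta_pure scaler_sumr.
  by apply: eq_bigr => j _; rewrite pureZ.
Qed.

Lemma ttheta0 x : ttheta 0%N x = x.
Proof.
elim/ttheta_ind: x => [|x y IHx IHy|a m]; first exact: ttheta_0.
  by rewrite tthetaD IHx IHy.
by rewrite ttheta_pure big_ord1 theta0 mtheta0.
Qed.

Lemma ttheta_comp i j x :
  ttheta i (ttheta j x) = ttheta (i + j)%N x *+ 'C(i + j, i).
Proof.
elim/ttheta_ind: x => [|x y IHx IHy|a m].
- by rewrite !ttheta_0 mul0rn.
- by rewrite !tthetaD IHx IHy mulrnDl.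
rewrite !ttheta_pure ttheta_sum.
pose G k := pure f (theta k a) (mtheta (i + j - k)%N m).
pose H k p := G k *+ ('C(k, p) * 'C(i + j - k, i - p)).
transitivity (\sum_(u < j.+1) \sum_(p < i.+1) H (p + u)%N p).
  apply: eq_bigr => u _; rewrite ttheta_pure; apply: eq_bigr => p _.
  have lpi : (p <= i)%N by rewrite -ltnS.
  have luj : (u <= j)%N by rewrite -ltnS.
  have e : (i - p + (j - u) = i + j - (p + u))%N.
    by rewrite addnBA // addnBAC // subnDA.
  by rewrite theta_comp mtheta_comp pureMnl pureMnr -mulrnA mulnC /H /G e.
rewrite exchange_big /=.
transitivity (\sum_(p < i.+1) \sum_(k < (i + j).+1) H k p).
  apply: eq_bigr => p _.
  have lpi : (p <= i)%N by rewrite -ltnS.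
  rewrite -(big_mkord predT (fun k => H k p)) (big_cat_nat (n := p)) //=;
    last by rewrite ltnW // ltnS (leq_trans lpi) ?leq_addr.
  rewrite [X in _ = X + _]big1_seq ?add0r; last first.
    move=> k; rewrite mem_index_iota /= => kp.
    by rewrite /H bin_small // mul0n mulr0n.
  rewrite (big_cat_nat (n := (p + j).+1)) /=; last first.
  - by rewrite ltnS leq_add2r.
  - by rewrite ltnW // ltnS leq_addr.
  rewrite [X in _ = _ + X]big1_seq ?addr0; last first.
    move=> k; rewrite mem_index_iota /= => /andP[k1 k2].
    rewrite /H [X in (_ * X)%N]bin_small ?muln0 ?mulr0n //.
    rewrite ltn_subLR; last by rewrite -ltnS.
    by rewrite addnBA // ltn_subRL addnA [(p + i)%N]addnC -addnA addnC ltn_add2r.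
  rewrite (_ : index_iota p _ = index_iota (0 + p) (p + j).+1) // big_addn.
  rewrite big_mkord -addnS addKn.
  by apply: eq_bigr => u _; rewrite addnC.
rewrite exchange_big -sumrMnl; apply: eq_bigr => k _ /=.
have lk : (k <= i + j)%N by rewrite -ltnS.
by rewrite /H sumrMnr binomial.Vandermonde subnKC.
Qed.

Lemma tensor_fg : exists (n : nat) (g : 'I_n -> N),
  forall x, exists c : 'I_n -> R, x = \sum_(i < n) c i *: g i.
Proof.
have [n [g gP]] := @finitely_generated S M.
exists n, (fun i => pure f 1 (g i)) => x.
elim/ttheta_ind: x => [|x y [c ->] [d ->]|a m].
- by exists (fun _ => 0); rewrite big1 // => i _; rewrite scale0r.
- exists (fun i => c i + d i); rewrite -big_split /=.
  by apply: eq_bigr => i _; rewrite scalerDl.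
- have [c ->] := gP m; exists (fun i => a * f (c i)); rewrite pure_sumr.
  by apply: eq_bigr => i _; rewrite pureZ mulr1 pureM.
Qed.

HB.instance Definition _ := isIDModule.Build R (tensor f M)
  tensor_fg tthetaD tthetaZ ttheta0 ttheta_comp.

End TensorTheta.

Definition solution_ring (S : idRingType) (M : idModType S)
    (R : idRingType) (f : idMorphism S R) : Prop :=
  [/\ ID_simple R,
      forall r : R, ID_constant r <-> exists2 c : S, ID_constant c & f c = r
    & ID_trivial (tensor f M : idModType R)].

(* An ID-homomorphism is an isomorphism as soon as it is bijective. *)
Definition Picard_Vessiot (S : idRingType) (M : idModType S)
    (R : idRingType) (f : idMorphism S R) : Prop :=
  solution_ring M f /\
  forall (R' : idRingType) (f' : idMorphism S R'), solution_ring M f' ->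
  forall g : idMorphism R' R, (forall s, g (f' s) = f s) -> bijective g.

(* Main.v *)
Require Import Defs.
From HB Require Import structures.
From mathcomp Require Import all_boot all_order all_algebra.
From mathcomp Require Import boolp zify.

Set Implicit Arguments.
Unset Strict Implicit.
Unset Printing Implicit Defensive.

Import GRing.Theory.
Local Open Scope ring_scope.
Local Open Scope quotient_scope.

(** The residue field at the rational point is written [k], and [eps] is the
    reduction map [S -> k].  Expanding [s] as the series with coefficients
    [eps (theta p s)] is a homomorphism of ID-rings from [S] to [k[[T]]]
    ([taylor]), injective because [S] is ID-simple.  Over [k[[T]]] the module
    [M] has a full set of solutions: if [lam_i] are coordinates on the fibre of
    [M] at the rational point, the series [y_i(x)] with coefficients
    [lam_i (mtheta p x)] are semilinear in [x] and commute with the derivations,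
    and their matrix on lifts [b_l] of a basis of the fibre is the identity
    modulo [T], hence invertible ([fiber_basis], [Picard_Vessiot_exists]).

    The Picard-Vessiot ring is the subring [R] of [k[[T]]] generated by [S], the
    [y_i(x)] for [x] in [M], and the solutions [z_i(phi)] of the dual module,
    which are characterized by [phi(x) = sum_i y_i(x) z_i(phi)] ([pairing]).  It
    is stable under the derivations, and its constants are those of [k[[T]]],
    namely [k], which is the image of the constants of [S].

    Triviality of [M] over [R].  [M] is projective: the scalars [s] for which
    multiplication by [s] is of the form [x |-> sum_j phi_j(x) g_j] form an
    ID-ideal of [S], which is nonzero because [M] is free of basis [b] after one
    element is inverted, and so contains 1 ([dual_basis]).  For such a dual
    basis the vectors [sum_j z_i(phi_j) (x) g_j] are constant and form a basis
    of [R (x) M] ([PV_ring_trivial]).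

    ID-simplicity of [R].  An element [r] of [R] is a coordinate of a vector
    that lives in an ID-module obtained from [M] and its dual by sums and tensor
    products; this is recorded by matrices in [framed].  The derivatives of this
    vector span a space which is stable under the derivations and hence defined
    over the constants ([constant_echelon]).  Clearing denominators with an
    element of [S] turns a constant vector of that space into a combination of
    derivatives of the given vector with coefficients in [R]; on the level of
    coordinates, a nonzero element of [S] becomes a combination of derivatives
    of [r] ([contraction_neq0]).  So every nonzero ID-ideal of [R] meets [S] in
    a nonzero ID-ideal, and contains 1.

    Minimality.  If [M] becomes trivial over [R'] and [R'] maps to [R], the
    [y_i] and the [z_i] are linear combinations, with coefficients in [k], of
    the coordinates with respect to a constant basis over [R'] and of the values
    of linear forms on that basis; so the image of [R'] contains all generators
    of [R] ([PV_ring_minimal]). *)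

(** * Formal power series *)

Definition pseries (k : Type) := nat -> k.

HB.instance Definition _ (k : choiceType) := Choice.copy (pseries k) (nat -> k).

Lemma ps_ext (k : Type) (u v : pseries k) : (forall n, u n = v n) -> u = v.
Proof. exact: funext. Qed.

Section PowerSeriesRing.
Variable k : comNzRingType.
Implicit Types u v w : pseries k.

Definition ps_zero : pseries k := fun=> 0.
Definition ps_add u v : pseries k := fun n => u n + v n.
Definition ps_opp u : pseries k := fun n => - u n.
Definition psC (c : k) : pseries k := fun n => if n == 0%N then c else 0.
Definition ps_mul u v : pseries k :=
  fun n => \sum_(i < n.+1) u i * v (n - i)%N.

Fact ps_addA : associative ps_add.
Proof. by move=> u v w; apply: ps_ext => n; apply: addrA. Qed.
Fact ps_addC : commutative ps_add.
Proof. by move=> u v; apply: ps_ext => n; apply: addrC. Qed.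
Fact ps_add0 : left_id ps_zero ps_add.
Proof. by move=> u; apply: ps_ext => n; apply: add0r. Qed.
Fact ps_addN : left_inverse ps_zero ps_opp ps_add.
Proof. by move=> u; apply: ps_ext => n; apply: addNr. Qed.

HB.instance Definition _ :=
  GRing.isZmodule.Build (pseries k) ps_addA ps_addC ps_add0 ps_addN.

Fact ps_mulA : associative ps_mul.
Proof.
move=> u v w; apply: ps_ext => n; rewrite /ps_mul.
transitivity (\sum_(i < n.+1) \sum_(j < (n - i).+1)
    u i * v j * w (n - i - j)%N).
  by apply: eq_bigr => i _; rewrite mulr_sumr; apply: eq_bigr => j _; rewrite mulrA.
rewrite -(sum_triangle n (fun i j l => u i * v j * w l)).
by apply: eq_bigr => i _; rewrite mulr_suml.
Qed.

Fact ps_mulC : commutative ps_mul.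
Proof.
move=> u v; apply: ps_ext => n; rewrite /ps_mul (reindex_inj rev_ord_inj) /=.
apply: eq_bigr => i _; rewrite subSS mulrC; congr (_ * u _).
by rewrite subKn // -ltnS.
Qed.

Fact ps_mul1 : left_id (psC 1) ps_mul.
Proof.
move=> u; apply: ps_ext => n; rewrite /ps_mul big_ord_recl /= mul1r subn0.
by rewrite big1 ?addr0 // => i _; rewrite mul0r.
Qed.

Fact ps_mulD : left_distributive ps_mul ps_add.
Proof.
move=> u v w; apply: ps_ext => n; rewrite /ps_add /ps_mul -big_split /=.
by apply: eq_bigr => i _; rewrite mulrDl.
Qed.

Fact ps_1neq0 : psC 1 != 0.
Proof.
by apply/eqP => /(congr1 (@^~ 0%N)) /eqP; apply/negP; rewrite oner_eq0.
Qed.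

HB.instance Definition _ := GRing.Zmodule_isComNzRing.Build (pseries k)
  ps_mulA ps_mulC ps_mul1 ps_mulD ps_1neq0.

Lemma ps0E n : (0 : pseries k) n = 0. Proof. by []. Qed.
Lemma psDE u v n : (u + v) n = u n + v n. Proof. by []. Qed.
Lemma psNE u n : (- u) n = - u n. Proof. by []. Qed.
Lemma ps1E n : (1 : pseries k) n = (n == 0%N)%:R.
Proof. by rewrite [LHS]/(psC 1 n) /psC; case: eqP. Qed.
Lemma psME u v n : (u * v) n = \sum_(i < n.+1) u i * v (n - i)%N.
Proof. by []. Qed.
Lemma psME0 u v : (u * v) 0%N = u 0%N * v 0%N.
Proof. by rewrite psME big_ord1. Qed.

Lemma ps_sumE (I : Type) (r : seq I) (P : pred I) (F : I -> pseries k) n :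
  (\sum_(i <- r | P i) F i) n = \sum_(i <- r | P i) F i n.
Proof. by elim/big_rec2: _ => // i a u _ <-. Qed.

Lemma psMnE u m n : (u *+ m) n = u n *+ m.
Proof. by elim: m => [|m IH]; rewrite ?mulr0n // !mulrS psDE IH. Qed.

Fact psC_is_zmod_morphism : zmod_morphism psC.
Proof.
by move=> a b; apply: ps_ext => n; rewrite psDE psNE /psC; case: eqP; rewrite ?subr0.
Qed.

Lemma psCME c u n : (psC c * u) n = c * u n.
Proof.
rewrite psME big_ord_recl /= subn0 big1 ?addr0 // => i _; exact: mul0r.
Qed.

Fact psC_is_monoid_morphism : monoid_morphism psC.
Proof.
split=> // a b; apply: ps_ext => n; rewrite psCME /psC.
by case: eqP; rewrite ?mulr0.
Qed.

HB.instance Definition _ :=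
  GRing.isZmodMorphism.Build k (pseries k) psC psC_is_zmod_morphism.
HB.instance Definition _ :=
  GRing.isMonoidMorphism.Build k (pseries k) psC psC_is_monoid_morphism.

Definition ps_coef0 u := u 0%N.
Fact ps_coef0_is_zmod_morphism : zmod_morphism ps_coef0.
Proof. by []. Qed.
Fact ps_coef0_is_monoid_morphism : monoid_morphism ps_coef0.
Proof. by split=> // u v; apply: psME0. Qed.
HB.instance Definition _ :=
  GRing.isZmodMorphism.Build (pseries k) k ps_coef0 ps_coef0_is_zmod_morphism.
HB.instance Definition _ :=
  GRing.isMonoidMorphism.Build (pseries k) k ps_coef0
    ps_coef0_is_monoid_morphism.

(** The substitution of [T + t] for [T]: the coefficient of [t ^ n] in
    [u(T + t)]. *)
Definition ps_theta n u : pseries k := fun p => u (n + p)%N *+ 'C(n + p, n).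

End PowerSeriesRing.

(** Regrouping the terms by [k = p + u], the coefficient of [G k] is computed by
    the Vandermonde identity. *)
Lemma binomial_convolution (V : nmodType) i j (G : nat -> V) :
  \sum_(p < i.+1) \sum_(u < j.+1)
     G (p + u)%N *+ ('C(p + u, p) * 'C(i - p + (j - u), i - p)) =
  \sum_(k < (i + j).+1) G k *+ 'C(i + j, i).
Proof.
pose H k p := G k *+ ('C(k, p) * 'C(i + j - k, i - p)).
transitivity (\sum_(p < i.+1) \sum_(k < (i + j).+1) H k p).
  apply: eq_bigr => p _.
  have lpi : (p <= i)%N by rewrite -ltnS.
  rewrite -(big_mkord predT (fun k => H k p)) (big_cat_nat (n := p)) //=;
    last by rewrite ltnW // ltnS (leq_trans lpi) ?leq_addr.
  rewrite [X in _ = X + _]big1_seq ?add0r; last first.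
    move=> k; rewrite mem_index_iota /= => kp.
    by rewrite /H bin_small // mul0n mulr0n.
  rewrite (big_cat_nat (n := (p + j).+1)) /=; last first.
  - by rewrite ltnS leq_add2r.
  - by rewrite ltnW // ltnS leq_addr.
  rewrite [X in _ = _ + X]big1_seq ?addr0; last first.
    move=> k; rewrite mem_index_iota /= => /andP[k1 k2].
    rewrite /H [X in (_ * X)%N]bin_small ?muln0 ?mulr0n //.
    rewrite ltn_subLR; last by rewrite -ltnS.
    by rewrite addnBA // ltn_subRL addnA [(p + i)%N]addnC -addnA addnC ltn_add2r.
  rewrite (_ : index_iota p _ = index_iota (0 + p) (p + j).+1) // big_addn.
  rewrite big_mkord -addnS addKn; apply: eq_bigr => u _.
  have luj : (u <= j)%N by rewrite -ltnS.
  by rewrite /H [(u + p)%N]addnC addnBA // addnBAC // subnDA.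
rewrite exchange_big /=; apply: eq_bigr => k _.
have lk : (k <= i + j)%N by rewrite -ltnS.
by rewrite /H sumrMnr binomial.Vandermonde subnKC.
Qed.

(** * The iterative derivation of formal power series *)

Section PowerSeriesTheta.
Variable k : comNzRingType.
Implicit Types u v w : pseries k.

Fact ps_thetaD n u v : ps_theta n (u + v) = ps_theta n u + ps_theta n v.
Proof. by apply: ps_ext => p; rewrite psDE /ps_theta psDE mulrnDl. Qed.

Fact ps_theta1 n : ps_theta n (1 : pseries k) = (n == 0%N)%:R.
Proof.
apply: ps_ext => p; rewrite /ps_theta ps1E; case: n => [|n] /=.
  by rewrite add0n bin0 mulr1n [RHS]ps1E.
by rewrite addSn mul0rn.
Qed.

Fact ps_thetaM n u v :
  ps_theta n (u * v) = \sum_(i < n.+1) ps_theta i u * ps_theta (n - i) v.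
Proof.
apply: ps_ext => p; rewrite /ps_theta psME ps_sumE -sumrMnl.
rewrite -(binomial_convolution n p (fun q => u q * v (n + p - q)%N)).
apply: eq_bigr => i _; rewrite psME; apply: eq_bigr => j _.
have lin : (i <= n)%N by rewrite -ltnS.
have ljp : (j <= p)%N by rewrite -ltnS.
rewrite /ps_theta mulrnAl mulrnAr -mulrnA mulnC; congr (_ * v _ *+ _).
by rewrite addnBA // addnBAC // subnDA.
Qed.

Fact ps_theta0 u : ps_theta 0 u = u.
Proof. by apply: ps_ext => p; rewrite /ps_theta add0n bin0. Qed.

(** Both sides equal [(i + j + p)! / (i! j! p!)]. *)
Fact trinomial i j p :
  ('C(i + j + p, j) * 'C(i + p, i) = 'C(i + j + p, i + j) * 'C(i + j, i))%N.
Proof.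
have fact_bin m n : ('C(m + n, m) * (m`! * n`!) = (m + n)`!)%N.
  by rewrite -[in n`!](addKn m n) bin_fact ?leq_addr.
have f_gt0 : (0 < i`! * j`! * p`!)%N by rewrite !muln_gt0 !fact_gt0.
apply/eqP; rewrite -(eqn_pmul2r f_gt0); apply/eqP.
transitivity (i + j + p)`!.
  rewrite -addnA addnCA -[RHS]fact_bin -[in RHS](fact_bin i p); nia.
rewrite -[LHS]fact_bin -[in LHS](fact_bin i j); nia.
Qed.

Fact ps_theta_comp i j u :
  ps_theta i (ps_theta j u) = ps_theta (i + j) u *+ 'C(i + j, i).
Proof.
apply: ps_ext => p; rewrite psMnE /ps_theta.
rewrite -!mulrnA addnA [(j + i)%N]addnC; congr (_ *+ _).
exact: trinomial.
Qed.

HB.instance Definition _ := isIDRing.Build (pseries k) ps_thetaD ps_theta1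
  ps_thetaM ps_theta0 ps_theta_comp.

Lemma ps_thetaE n u p : theta n u p = u (n + p)%N *+ 'C(n + p, n).
Proof. by []. Qed.

Lemma ps_constantP u : ID_constant u <-> u = psC (u 0%N).
Proof.
split=> [h|->].
  apply: ps_ext => -[//|n].
  by have := congr1 (@^~ 0%N) (h n.+1); rewrite ps_thetaE addn0 binn mulr1n.
move=> n; apply: ps_ext => p; rewrite ps_thetaE /psC.
by case: n => [|n] /=; rewrite ?add0n ?bin0 // addSn mul0rn.
Qed.

End PowerSeriesTheta.

(** * Power series over a field *)

Section PowerSeriesDomain.
Variable k : fieldType.
Implicit Types u v w : pseries k.

Lemma ps_neq0 u : u != 0 ->
  exists p, u p != 0 /\ forall i, (i < p)%N -> u i = 0.
Proof.
move=> u0; have ex : exists p, u p != 0.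
  apply: contrapT => h; case/eqP: u0; apply: ps_ext => p.
  by apply/eqP/negPn/negP => up; apply: h; exists p.
exists (ex_minn ex); case: ex_minnP => p up hp; split=> // i ip.
by apply/eqP/negPn/negP => /hp; rewrite leqNgt ip.
Qed.

Fact ps_mulf_eq0 u v : u * v = 0 -> (u == 0) || (v == 0).
Proof.
move=> uv; apply/norP => -[/ps_neq0[p [up hp]] /ps_neq0[q [vq hq]]].
have := congr1 (@^~ (p + q)%N) uv; rewrite psME ps0E.
have lp : (p < (p + q).+1)%N by rewrite ltnS leq_addr.
rewrite (bigD1 (Ordinal lp)) //= addKn big1 ?addr0 => [|i ip].
  by apply/eqP; rewrite mulf_neq0.
case: (ltngtP i p) => [/hp->|pi|ep]; first by rewrite mul0r.
- rewrite hq ?mulr0 //; have := ltn_ord i; lia.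
- by case/eqP: ip; apply: val_inj.
Qed.

Lemma ps_exp_small w : w 0%N = 0 -> forall i p, (p < i)%N -> (w ^+ i) p = 0.
Proof.
move=> w0; elim=> // i IH p pi; rewrite exprS psME big_ord_recl /= w0 mul0r.
rewrite add0r big1 // => j _; rewrite IH ?mulr0 //.
rewrite /bump /=; have := ltn_ord j; lia.
Qed.

(** The geometric series; its [p]-th coefficient only involves the first
    [p + 1] terms. *)
Definition ps_geom w : pseries k := fun p => (\sum_(i < p.+1) w ^+ i) p.

Lemma ps_geomP w : w 0%N = 0 -> ps_geom w * (1 - w) = 1.
Proof.
move=> w0; apply: ps_ext => n.
have -> : (ps_geom w * (1 - w)) n = ((\sum_(i < n.+1) w ^+ i) * (1 - w)) n.
  rewrite !psME; apply: eq_bigr => j _; congr (_ * _).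
  have jn : (j < n.+1)%N := ltn_ord j.
  rewrite /ps_geom -!(big_mkord predT (fun i => w ^+ i)).
  rewrite [in RHS](big_cat_nat (n := j.+1)) //= psDE [X in _ + X]ps_sumE.
  rewrite [X in _ = _ + X]big_nat [X in _ = _ + X]big1 ?addr0 // => i /andP[ji _].
  exact: ps_exp_small.
rewrite mulrC -opprB mulNr -subrX1 opprB psDE psNE ps_exp_small //.
by rewrite subr0.
Qed.

Lemma ps_invertible u : u 0%N != 0 -> exists v, v * u = 1.
Proof.
move=> u0; pose c := psC (u 0%N)^-1.
have w0 : (1 - c * u) 0%N = 0.
  by rewrite psDE psNE ps1E psCME mulVf // subrr.
by exists (ps_geom (1 - c * u) * c); have := ps_geomP w0; rewrite subKr mulrA.
Qed.

Definition ps_unit : {pred pseries k} := fun u => `[< exists v, v * u = 1 >].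
Definition ps_inv u : pseries k :=
  if pselect (exists v, v * u = 1) is left h then sval (cid h)
  else u.

Fact ps_mulVx : {in ps_unit, left_inverse 1 ps_inv *%R}.
Proof.
move=> u /asboolP h; rewrite /ps_inv; case: pselect => // h'.
exact: (svalP (cid h')).
Qed.
Fact ps_unitPl u v : v * u = 1 -> ps_unit u.
Proof. by move=> h; apply/asboolP; exists v. Qed.
Fact ps_invr_out : {in [predC ps_unit], ps_inv =1 id}.
Proof.
move=> u; rewrite inE /= => /asboolP h; rewrite /ps_inv.
by case: pselect.
Qed.

HB.instance Definition _ := GRing.ComNzRing_hasMulInverse.Build (pseries k)
  ps_mulVx ps_unitPl ps_invr_out.
HB.instance Definition _ := GRing.ComUnitRing_isIntegral.Build (pseries k)
  ps_mulf_eq0.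

Lemma ps_unitE u : u 0%N != 0 -> u \is a GRing.unit.
Proof. by move=> /ps_invertible[v vu]; apply/unitrPr; exists v; rewrite mulrC. Qed.

End PowerSeriesDomain.

(** * Derivation-stable row spaces are defined over the constants *)

Section FieldMatrices.
Variable F : fieldType.

Lemma row_free_colsub_unit r n (A : 'M[F]_(r, n)) :
  row_free A -> exists g : 'I_r -> 'I_n, colsub g A \in unitmx.
Proof.
move=> fA; have fA' : row_full A^T by rewrite /row_full mxrank_tr.
exists (fullrankfun fA'); rewrite -unitmx_tr.
by rewrite trmx_mxsub fullrowsub_unit.
Qed.

(** A row-free selection of maximal size spans all the rows, since any row
    outside its span could be added to it. *)
Lemma sequence_basis n (a : nat -> 'rV[F]_n) :
  exists r (ka : 'I_r -> nat), let A := \matrix_i a (ka i) in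
    row_free A /\ forall j, (a j <= A)%MS.
Proof.
pose Q r := `[< exists ka : 'I_r -> nat, row_free (\matrix_i a (ka i)) >].
have Q0 : exists r, Q r.
  exists 0%N; apply/asboolP; exists (fun=> 0%N).
  by rewrite -row_leq_rank.
have Qn r : Q r -> (r <= n)%N.
  by move=> /asboolP[ka /eqP <-]; apply: rank_leq_col.
have [r /asboolP[ka fA] maxr] := ex_maxnP Q0 Qn.
exists r, ka; split=> // j; set A := \matrix_i _ in fA *.
apply/negPn/negP => ajA; suff /maxr : Q (r + 1)%N by rewrite addn1 ltnn.
apply/asboolP.
exists (fun i => if split i is inl i' then ka i' else j).
have -> : \matrix_i a (if split i is inl i' then ka i' else j) =
          col_mx A (a j).
  apply/row_matrixP => i; rewrite rowK.
  rewrite -[i]splitK unsplitK; case: (split i) => i' /=.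
    by rewrite rowKu rowK.
  by rewrite rowKd row_id.
rewrite -row_leq_rank -addsmxE addn1.
rewrite -[r in (r < _)%N](eqP fA) rank_ltmx // ltmxE addsmxSl /=.
by apply: contra ajA; apply: submx_trans; apply: addsmxSr.
Qed.

End FieldMatrices.

Section ConstantEchelon.
Variable k : fieldType.
Local Notation L := (pseries k).
Local Notation toF := (map_mx (@FracField.tofrac L)).

(** By Taylor's formula the hypothesis reads
    [e(T) u(T + t) = sum_i d_i(T + t) E_i(T)].  Since [T] and [T + t] are
    independent variables, so are [T] and [X] in
    [e(T) u(X) = sum_i d_i(X) E_i(T)], whose coefficients are compared in the
    conclusion.  The induction on the degree in [T] performs this change of
    variables. *)
Lemma coef_separation (I : finType) (e u : L) (d E : I -> L) :
  (forall l, e * theta l u = \sum_i theta l (d i) * E i) ->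
  forall p m, e p * u m = \sum_i d i m * E i p.
Proof.
move=> h p; elim/ltn_ind: p => p IH m.
have := congr1 (@^~ p) (h m); rewrite ps_sumE psME big_ord_recr /= subnn.
under [X in _ = X -> _]eq_bigr => i _ do
  rewrite mulrC psME big_ord_recr /= subnn.
rewrite big_split /= exchange_big /=.
have -> : \sum_(i < p) e i * theta m u (p - i)%N =
    \sum_(j < p) \sum_i E i j * theta m (d i) (p - j)%N.
  apply: eq_bigr => j _; rewrite ps_thetaE mulrnAr IH // -sumrMnl.
  by apply: eq_bigr => i _; rewrite ps_thetaE mulrnAr mulrC.
move/addrI; rewrite ps_thetaE addn0 binn mulr1n => ->.
by apply: eq_bigr => i _; rewrite ps_thetaE addn0 binn mulr1n mulrC.
Qed.

Lemma toF_inj m n : injective (toF : 'M[L]_(m, n) -> _).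
Proof.
move=> A B /matrixP h; apply/matrixP => i j; have := h i j; rewrite !mxE.
by move/eqP; rewrite tofrac_eq => /eqP.
Qed.

(** Let [D] be an invertible maximal minor of [V].  Vectors of the row space are
    determined by their pivot entries, so that
    [theta_l(V) = theta_l(D) (D^-1 V)] for every [l].  With
    [D^-1 V = E / det D], [coef_separation] shows that [D^-1 V] is the quotient
    of the coefficients of [E] and of [det D] in any degree where the latter is
    nonzero; in particular [D^-1 V] is constant. *)
Lemma constant_echelon r n (V : 'M[L]_(r, n)) :
  row_free (toF V) ->
  (forall l, (toF (map_mx (theta l) V) <= toF V)%MS) ->
  exists (D : 'M[L]_r) (W : 'M[k]_(r, n)),
    \det D != 0 /\ V = D *m map_mx (@psC k) W.
Proof.
move=> fV hV; have [g] := row_free_colsub_unit fV.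
rewrite -map_mxsub unitmxE det_map_mx unitfE tofrac_eq0.
set D := colsub g V => D0; pose E := \adj D *m V.
have key l : \det D *: map_mx (theta l) V = map_mx (theta l) D *m E.
  have [c hc] := submxP (hV l); apply: toF_inj.
  rewrite map_mxZ map_mxM [in RHS]/D map_mxsub map_mxsub hc -mulmx_colsub.
  rewrite -map_mxsub -/D map_mxM mulmxA -[_ *m _ *m toF (\adj D)]mulmxA.
  by rewrite -map_mxM mul_mx_adj map_scalar_mx mul_mx_scalar -scalemxAl.
(* In degree [p] the common denominator [det D] may be divided out. *)
have [p [Dp _]] := ps_neq0 D0.
exists D, (\matrix_(i, j) ((\det D p)^-1 * E i j p)); split=> //.
apply/matrixP => i j; apply: ps_ext => m.
have key' l : \det D * theta l (V i j) = \sum_q theta l (D i q) * E q j.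
  have /matrixP/(_ i j) := key l; rewrite !mxE => ->.
  by apply: eq_bigr => q _; rewrite !mxE.
apply: (mulfI Dp); rewrite (coef_separation key') mxE ps_sumE mulr_sumr.
apply: eq_bigr => q _; rewrite !mxE [V i (g q) * _]mulrC psCME.
by rewrite mulrA mulVKf // mulrC.
Qed.

End ConstantEchelon.

(** * Nonzero derivation-stable ideals meet the base ring *)

Lemma theta_sum (A : idRingType) n (I : Type) (r : seq I) (P : pred I)
    (F : I -> A) :
  theta n (\sum_(i <- r | P i) F i) = \sum_(i <- r | P i) theta n (F i).
Proof. exact: (big_morph (theta n) (thetaD n) (theta_0 A n)). Qed.

Lemma thetaMn (A : idRingType) n (a : A) m : theta n (a *+ m) = theta n a *+ m.
Proof. by elim: m => [|m IH]; rewrite ?mulr0n ?theta_0 // !mulrS thetaD IH. Qed.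

Lemma theta_opp (A : idRingType) n (a : A) : theta n (- a) = - theta n a.
Proof. by apply: (addIr (theta n a)); rewrite -thetaD !addNr theta_0. Qed.

Lemma theta_constM (A : idRingType) n (c a : A) :
  ID_constant c -> theta n (c * a) = c * theta n a.
Proof.
move=> hc; rewrite thetaM big_ord_recl /= hc /= subn0 big1 ?addr0 // => i _.
by rewrite hc mul0r.
Qed.

Lemma mulmx_detIl (A : idomainType) m n (B : 'M[A]_m) (X Y : 'M[A]_(m, n)) :
  \det B != 0 -> B *m X = B *m Y -> X = Y.
Proof.
move=> B0 /(congr1 (mulmx (\adj B))); rewrite !mulmxA mul_adj_mx !mul_scalar_mx.
move/matrixP => h; apply/matrixP => i j; have := h i j; rewrite !mxE.
by move/(mulfI B0).
Qed.

Lemma mulmx_detI (A : idomainType) m n (B : 'M[A]_n) (X Y : 'M[A]_(m, n)) :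
  \det B != 0 -> X *m B = Y *m B -> X = Y.
Proof.
rewrite -det_tr => B0 /(congr1 trmx); rewrite !trmx_mul => /(mulmx_detIl B0).
exact: trmx_inj.
Qed.

Section Contraction.
Variables (S : idRingType) (k : fieldType).
Local Notation L := (pseries k).
Variables (f : idMorphism S L) (P : subringClosed L) (I : L -> Prop).
Hypothesis f_inj : injective f.
Hypothesis baseP : forall s, f s \in P.
Hypothesis constP : forall c : k, psC c \in P.
Hypothesis I_0 : I 0.
Hypothesis I_add : forall x y, I x -> I y -> I (x + y).
Hypothesis I_mul : forall x y, x \in P -> I y -> I (x * y).
Hypothesis I_theta : forall j x, I x -> I (theta j x).
Local Notation toF := (map_mx (@FracField.tofrac L)).
Local Notation "x %:F" := (@FracField.tofrac L x) (at level 1, format "x %:F").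
Local Notation fm := (map_mx f).

(** Up to the factor [s], all derivatives of [v] have coordinates [a j] in [S]
    with respect to the rows of [B].  Finitely many of the derivatives, the rows
    of [V], span the others over the fraction field, and [V = D W] with [W]
    constant.  Let [A] be the matrix of coordinates of [V].  As [s = rho B],
    also [A = D (W rho)]; so for a nonzero maximal minor [d] of [A], which lies
    in [S], there is [G] with entries in [P] such that [G D] is the scalar
    matrix [d].  Then [G V = d W].
    Multiplied by [l], the left-hand side has entries in [I], being made of
    derivatives of [r]; and [W l] has a nonzero entry, which is a constant. *)
Lemma contraction_neq0 n (v : 'rV[L]_n) (B rho : 'M[L]_n) (s : S)
    (l : 'cV[k]_n) : s != 0 ->
  (forall j, exists a : 'rV[S]_n, f s *: map_mx (theta j) v = fm a *m B) ->
  (f s)%:M = rho *m B -> (forall i j, rho i j \in P) ->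
  let r := (v *m map_mx (@psC k) l) 0 0 in
  I r -> r != 0 -> exists2 d, d != 0 & I (f d).
Proof.
move=> s0 /choice[a ha] rhoB Prho r Ir r0.
have fs0 : f s != 0 by rewrite -(rmorph0 f) (inj_eq f_inj).
have Fs0 : (f s)%:F != 0 by rewrite tofrac_eq0.
have [q [ka []]] := sequence_basis (fun j => toF (fm (a j))).
set AF := \matrix_i _ => fA hA.
pose A := \matrix_i a (ka i).
pose V := \matrix_(i < q) map_mx (theta (ka i)) v.
have AFE : AF = toF (fm A).
  by apply/row_matrixP => i; rewrite rowK -!map_row rowK.
have sV : f s *: V = fm A *m B.
  apply/row_matrixP => i.
  by rewrite row_mul -map_row linearZ /= !rowK ha.
have B0 : \det B != 0.
  apply/eqP => B0; have := congr1 determinant rhoB.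
  by move/eqP; rewrite det_mulmx B0 mulr0 det_scalar expf_eq0 (negPf fs0) andbF.
have BU : toF B \in unitmx by rewrite unitmxE det_map_mx unitfE tofrac_eq0.
have fV : row_free (toF V).
  have AV : toF (fm A) = ((f s)%:F *: toF V) *m invmx (toF B).
    by rewrite -map_mxZ sV map_mxM mulmxK.
  have: (q <= \rank AF)%N by rewrite (eqP fA).
  rewrite AFE AV -row_leq_rank => /leq_trans; apply.
  apply: (leq_trans (mxrankM_maxl _ _)).
  by rewrite (eqmx_scale (toF V) Fs0) leqnn.
have hv j : (toF (map_mx (theta j) v) <= toF V)%MS.
  have [c hc] := submxP (hA j); apply/submxP; exists c.
  apply: (scalerI Fs0); rewrite -map_mxZ ha map_mxM hc AFE -mulmxA -map_mxM -sV.
  by rewrite map_mxZ scalemxAr.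
have hV j : (toF (map_mx (theta j) V) <= toF V)%MS.
  apply/row_subP => i; rewrite -!map_row rowK.
  have -> : map_mx (theta j) (map_mx (theta (ka i)) v) =
      map_mx (theta (j + ka i)%N) v *+ 'C(j + ka i, j).
    by apply/rowP => p; rewrite mulmxnE !mxE theta_comp.
  by rewrite raddfMn /= -scaler_nat scalemx_sub.
have [D [W [D0 VDW]]] := constant_echelon fV hV.
pose Wr := map_mx (@psC k) W *m rho.
have ADW : fm A = D *m Wr.
  apply: (mulmx_detI B0).
  by rewrite -sV VDW /Wr -!mulmxA -rhoB mul_mx_scalar scalemxAr.
(* [d] is the minor of [A] on the pivot columns [g]. *)
have [g] := row_free_colsub_unit fA.
rewrite AFE -!map_mxsub unitmxE !det_map_mx unitfE tofrac_eq0.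
set d := \det _ => fd0.
have d0 : d != 0 by apply: contraNneq fd0 => ->; rewrite rmorph0.
exists d => //.
pose G := colsub g Wr *m fm (\adj (colsub g A)).
have DG : D *m G = (f d)%:M.
  rewrite mulmxA mulmx_colsub -ADW -map_mxsub -map_mxM mul_mx_adj.
  by rewrite map_scalar_mx.
(* A right inverse of [D] up to [d] is a left inverse up to [d]. *)
have GD : G *m D = (f d)%:M.
  by apply: (mulmx_detIl D0); rewrite mulmxA DG mul_scalar_mx mul_mx_scalar.
have GP i j : G i j \in P.
  rewrite mxE rpred_sum // => p _; rewrite !mxE rpredM //.
  by rewrite rpred_sum // => p' _; rewrite mxE rpredM.
pose w := W *m l.
have Vl : V *m map_mx (@psC k) l = D *m map_mx (@psC k) w.
  by rewrite VDW -mulmxA -map_mxM.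
have VlI i : I ((V *m map_mx (@psC k) l) i 0).
  have -> : (V *m map_mx (@psC k) l) i 0 = theta (ka i) r.
    rewrite /r [LHS]mxE [in RHS]mxE theta_sum; apply: eq_bigr => p _; rewrite !mxE.
    by rewrite mulrC [in RHS]mulrC theta_constM //; apply/ps_constantP.
  exact: I_theta.
have [i wi] : exists i, w i 0 != 0.
  apply: contrapT => hw; case/eqP: r0.
  have w0 : w = 0.
    apply/colP => i; rewrite [RHS]mxE; apply/eqP/negPn/negP => wi.
    by apply: hw; exists i.
  have v0 : map_mx (theta 0) v = v by apply/rowP => p; rewrite mxE theta0.
  have [c] := submxP (hv 0%N); rewrite v0 => hc.
  have : toF (v *m map_mx (@psC k) l) = 0.
    by rewrite map_mxM hc -mulmxA -map_mxM Vl w0 !raddf0.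
  move/matrixP/(_ 0 0); rewrite [LHS]mxE [RHS]mxE => /eqP.
  by rewrite tofrac_eq0 => /eqP.
have dwI : I (f d * psC (w i 0)).
  have : G *m (V *m map_mx (@psC k) l) = f d *: map_mx (@psC k) w.
    by rewrite Vl mulmxA GD mul_scalar_mx.
  move/matrixP/(_ i 0); rewrite [RHS]mxE [in RHS]mxE => <-.
  rewrite mxE; elim/big_ind: _ => [|x y|p _]; [exact: I_0|exact: I_add|].
  exact: I_mul.
suff -> : f d = psC (w i 0)^-1 * (f d * psC (w i 0)) by apply: I_mul.
by rewrite mulrCA -rmorphM mulVf // rmorph1 mulr1.
Qed.
End Contraction.

(** * ID-ideals, ID-subrings and Taylor expansion *)

Lemma ideal_of_predicate (R : comNzRingType) (Q : R -> Prop) :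
  Q 0 -> ~ Q 1 -> (forall a u v, Q u -> Q v -> Q (a * u + v)) ->
  exists J : idealr R, forall x, x \in J <-> Q x.
Proof.
move=> Q0 Q1 Qlin; pose J : {pred R} := fun x => `[< Q x >].
have JE x : x \in J <-> Q x by split=> /asboolP.
have Jc : idealr_closed J.
  split=> [||a u v /JE Qu /JE Qv]; first exact/JE.
    by apply/negP => /JE.
  by apply/JE/Qlin.
pose JJ : idealr R := HB.pack (J : R -> bool) (isIdealr.Build R J Jc).
by exists JJ.
Qed.

Lemma ID_simple_ideal1 (R : idRingType) (Q : R -> Prop) : ID_simple R ->
  Q 0 -> (forall a u v, Q u -> Q v -> Q (a * u + v)) ->
  (forall n u, Q u -> Q (theta n u)) ->
  forall x, Q x -> x != 0 -> Q 1.
Proof.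
move=> hR Q0 Qlin Qth x Qx x0; apply: contrapT => Q1.
have [J JE] := ideal_of_predicate Q0 Q1 Qlin.
case/eqP: x0; apply: (hR J); last exact/JE.
by move=> n r /JE Qr; apply/JE/Qth.
Qed.

(** The kernel is a proper ID-ideal. *)
Lemma ID_simple_inj (R A : idRingType) (g : idMorphism R A) :
  ID_simple R -> injective g.
Proof.
move=> hR x y gxy; apply/eqP; rewrite -subr_eq0; apply/negPn/negP => xy0.
have : g 1 = 0; last by apply/eqP; rewrite rmorph1 oner_eq0.
apply: (@ID_simple_ideal1 R (fun u => g u = 0) hR _ _ _ (x - y)) => //.
- exact: rmorph0.
- by move=> a u v gu gv; rewrite rmorphD rmorphM /= gu gv mulr0 addr0.
- by move=> n u gu; rewrite theta_morph gu theta_0.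
- by rewrite rmorphB /= gxy subrr.
Qed.

HB.mixin Record isThetaStable (L : idRingType) (P : L -> bool) := {
  theta_stable : forall n u, u \in P -> theta n u \in P
}.
#[short(type="idSubring")]
HB.structure Definition IDSubring (L : idRingType) :=
  {P of isThetaStable L P & GRing.SubringClosed L P}.

Section SubIDRing.
Variables (L : idRingType) (P : idSubring L).

Definition subID := {x : L | x \in P}.
HB.instance Definition _ := [isSub of subID for @sval L _].
HB.instance Definition _ := [Choice of subID by <:].
HB.instance Definition _ := [SubChoice_isSubComNzRing of subID by <:].

Definition subID_theta n (u : subID) : subID :=
  Sub (theta n (val u)) (@theta_stable L P n _ (valP u)).

Fact subID_thetaD n a b : subID_theta n (a + b) = subID_theta n a + subID_theta n b.
Proof. by apply: val_inj; apply: thetaD. Qed.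
Fact subID_theta1 n : subID_theta n 1 = (n == 0%N)%:R.
Proof. by apply: val_inj; rewrite rmorph_nat; apply: theta1. Qed.
Fact subID_thetaM n a b : subID_theta n (a * b) =
  \sum_(i < n.+1) subID_theta i a * subID_theta (n - i)%N b.
Proof. by apply: val_inj; rewrite rmorph_sum; apply: thetaM. Qed.
Fact subID_theta0 a : subID_theta 0 a = a.
Proof. by apply: val_inj; apply: theta0. Qed.
Fact subID_theta_comp i j a : subID_theta i (subID_theta j a) =
  subID_theta (i + j) a *+ 'C(i + j, i).
Proof. by apply: val_inj; rewrite rmorphMn; apply: theta_comp. Qed.

HB.instance Definition _ := isIDRing.Build subID subID_thetaD subID_theta1
  subID_thetaM subID_theta0 subID_theta_comp.

Definition subID_val : subID -> L := val.
HB.instance Definition _ := GRing.RMorphism.on subID_val.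
Fact subID_val_theta n u : subID_val (theta n u) = theta n (subID_val u).
Proof. by []. Qed.
HB.instance Definition _ := isIDMorphism.Build subID L subID_val subID_val_theta.

Section Corestriction.
Variables (S : idRingType) (f : idMorphism S L) (fP : forall s, f s \in P).

Definition corestrict (s : S) : subID := Sub (f s) (fP s).
Fact corestrict_zmod : zmod_morphism corestrict.
Proof. by move=> a b; apply: val_inj; apply: (rmorphB f). Qed.
Fact corestrict_monoid : monoid_morphism corestrict.
Proof.
by split=> [|a b]; apply: val_inj; [apply: (rmorph1 f)|apply: (rmorphM f)].
Qed.
HB.instance Definition _ :=
  GRing.isZmodMorphism.Build S subID corestrict corestrict_zmod.
HB.instance Definition _ :=
  GRing.isMonoidMorphism.Build S subID corestrict corestrict_monoid.
Fact corestrict_theta n s : corestrict (theta n s) = theta n (corestrict s).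
Proof. by apply: val_inj; apply: theta_morph. Qed.
HB.instance Definition _ :=
  isIDMorphism.Build S subID corestrict corestrict_theta.
End Corestriction.
End SubIDRing.

Section Taylor.
Variables (S : idRingType) (k : comNzRingType) (eps : {rmorphism S -> k}).
Definition taylor (s : S) : pseries k := fun p => eps (theta p s).
Fact taylor_zmod : zmod_morphism taylor.
Proof.
by move=> a b; apply: ps_ext => p; rewrite /taylor thetaD theta_opp rmorphB.
Qed.
Fact taylor_monoid : monoid_morphism taylor.
Proof.
split=> [|a b]; apply: ps_ext => p; rewrite /taylor.
  by rewrite theta1 rmorph_nat ps1E.
rewrite thetaM rmorph_sum; apply: eq_bigr => i _.
by rewrite rmorphM.
Qed.
HB.instance Definition _ :=
  GRing.isZmodMorphism.Build S (pseries k) taylor taylor_zmod.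
HB.instance Definition _ :=
  GRing.isMonoidMorphism.Build S (pseries k) taylor taylor_monoid.
Fact taylor_theta n s : taylor (theta n s) = theta n (taylor s).
Proof.
apply: ps_ext => p; rewrite ps_thetaE /taylor theta_comp addnC rmorphMn.
by rewrite -(bin_sub (leq_addr p n)) addKn.
Qed.
HB.instance Definition _ :=
  isIDMorphism.Build S (pseries k) taylor taylor_theta.
Lemma taylor_constant s : ID_constant s -> taylor s = psC (eps s).
Proof. by move=> hs; apply: ps_ext => -[|p]; rewrite /taylor hs ?rmorph0. Qed.
End Taylor.

(** * Coordinates on the fibre at the rational point *)

Section Fiber.
Variables (S : idRingType) (k : fieldType) (eps : {rmorphism S -> k}).
Variable M : idModType S.
Hypothesis eps_surj : forall x : k, exists c, eps c = x.

(** Let [m] be the kernel of [eps].  The family [b] is a smallest one that spans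
    [M] modulo [m M]; by minimality coordinates modulo [m] are unique, which
    makes [lam] well defined and linear.  For generators [g] of [M] one has
    [g = c b + mu g] with the entries of [mu] in [m]; by Cramer's rule
    [s = det (1 - mu)] maps [M] into the span of [b], and [s] is nonzero, being
    1 modulo [m]. *)
Lemma fiber_basis : exists n (b : 'I_n -> M) (lam : M -> 'I_n -> k),
  [/\ forall x y i, lam (x + y) i = lam x i + lam y i,
      forall s x i, lam (s *: x) i = eps s * lam x i,
      forall i j, lam (b j) i = (j == i)%:R
    & exists2 s, s != 0 &
      forall x, exists a : 'I_n -> S, s *: x = \sum_l a l *: b l].
Proof.
have [N [g gP]] := @finitely_generated S M.
pose small (x : M) := exists mu : 'I_N -> S,
  (forall j, eps (mu j) = 0) /\ x = \sum_j mu j *: g j.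
have small0 : small 0.
  exists (fun=> 0); split=> [j|]; first exact: rmorph0.
  by rewrite big1 // => j _; rewrite scale0r.
have smallD x y : small x -> small y -> small (x + y).
  move=> [mu [mu0 ->]] [nu [nu0 ->]]; exists (fun j => mu j + nu j); split.
    by move=> j; rewrite rmorphD /= mu0 nu0 addr0.
  by rewrite -big_split; apply: eq_bigr => j _; rewrite scalerDl.
have smallZ c x : small x -> small (c *: x).
  move=> [mu [mu0 ->]]; exists (fun j => c * mu j); split.
    by move=> j; rewrite rmorphM /= mu0 mulr0.
  by rewrite scaler_sumr; apply: eq_bigr => j _; rewrite scalerA.
have smallN x : small x -> small (- x) by rewrite -scaleN1r; apply: smallZ.
have smallK c x : eps c = 0 -> small (c *: x).
  move=> c0; have [d ->] := gP x; exists (fun j => c * d j); split.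
    by move=> j; rewrite rmorphM /= c0 mul0r.
  by rewrite scaler_sumr; apply: eq_bigr => j _; rewrite scalerA.
pose spans n (b : 'I_n -> M) := forall x, exists c : 'I_n -> S,
  small (x - \sum_l c l *: b l).
have ex : exists n, `[< exists b : 'I_n -> M, spans n b >].
  exists N; apply/asboolP; exists g => x; have [c ->] := gP x.
  by exists c; rewrite subrr.
case: (ex_minnP ex) => n /asboolP[b bP] minn.
have indep c : small (\sum_l c l *: b l) -> forall l, eps (c l) = 0.
  move=> cb p; apply/eqP/negPn/negP => cp.
  case: n => [|n] in b bP minn c cb p cp *; first by case: p cp.
  (* If [c p] is invertible modulo [m], then [b p] can be left out. *)
  suff /minn : `[< exists b : 'I_n -> M, spans n b >] by rewrite ltnn.
  apply/asboolP; exists (fun l => b (lift p l)) => x.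
  have [d dP] := bP x; have [t tP] := eps_surj (eps (c p))^-1.
  exists (fun l => d (lift p l) - d p * t * c (lift p l)).
  have -> : x - \sum_l (d (lift p l) - d p * t * c (lift p l)) *: b (lift p l)
    = (x - \sum_l d l *: b l) + (d p * t) *: (\sum_l c l *: b l)
      + (d p * (1 - t * c p)) *: b p.
    rewrite !(bigD1_ord p) //= scalerDr scaler_sumr scalerA.
    under eq_bigr => l _ do rewrite scalerBl -scalerA.
    rewrite sumrB mulrBr mulr1 mulrA scalerBl opprB [in RHS]opprD.
    move: (d p *: b p) ((d p * t * c p) *: b p) => u w.
    move: (\sum_(i < n) d _ *: _) (\sum_(i < n) _) => s1 s2.
    rewrite [w + s2]addrC -[RHS]addrA -[s2 + w + _]addrA [w + _]addrC subrK.
    by rewrite [- u - s1]addrC !addrA [x - s1 - u + s2]addrAC subrK addrAC.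

  refine (smallD _ _ (smallD _ _ dP (smallZ _ _ cb)) _).
  apply: smallK; rewrite rmorphM rmorphB rmorphM rmorph1 /= tP mulVf //.
  by rewrite subrr mulr0.
have [co coP] := choice bP.
have coE x c : small (x - \sum_l c l *: b l) -> forall l, eps (co x l) = eps (c l).
  move=> xc l; apply/eqP; rewrite -subr_eq0 -rmorphB; apply/eqP.
  apply: (indep (fun l => co x l - c l)).
  under eq_bigr => i _ do rewrite scalerBl.
  rewrite sumrB.
  have -> : \sum_l co x l *: b l - \sum_l c l *: b l =
      (x - \sum_l c l *: b l) + - (x - \sum_l co x l *: b l).
    by rewrite opprB [RHS]addrC addrA subrK.
  exact: (smallD _ _ xc (smallN _ (coP x))).
exists n, b, (fun x l => eps (co x l)); split.
- move=> x y l; rewrite -rmorphD; apply: (coE _ (fun l => co x l + co y l)).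
  under eq_bigr => i _ do rewrite scalerDl.
  by rewrite big_split opprD addrACA; apply: smallD.
- move=> s x l; rewrite -rmorphM; apply: (coE _ (fun l => s * co x l)).
  under eq_bigr => i _ do rewrite -scalerA.
  by rewrite -scaler_sumr -scalerBr; apply: smallZ.
- move=> i j; rewrite -(rmorph_nat eps).
  apply: (coE _ (fun l => (j == l)%:R)).
  rewrite (bigD1 j) //= eqxx scale1r big1 ?addr0 ?subrr // => l.
  by rewrite eq_sym => /negPf ->; rewrite scale0r.
have /choice[mu muP] : forall j, exists mu : 'I_N -> S, (forall i, eps (mu i) = 0)
    /\ g j - \sum_l co (g j) l *: b l = \sum_i mu i *: g i.
  by move=> j; apply: coP.
pose A : 'M[S]_N := 1%:M - \matrix_(i, j) mu i j.
have Ag i : \sum_j A i j *: g j = \sum_l co (g i) l *: b l.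
  under eq_bigr => j _ do rewrite !mxE scalerBl.
  rewrite sumrB -(muP i).2 (bigD1 i) //= eqxx scale1r big1 ?addr0.
    by rewrite opprB addrC subrK.
  by move=> j; rewrite eq_sym => /negPf ->; rewrite scale0r.
have epsA : map_mx eps A = 1%:M.
  by apply/matrixP => i j; rewrite !mxE rmorphB /= (muP i).1 subr0 rmorph_nat.
exists (\det A).
  apply/eqP => A0; have := congr1 determinant epsA.
  by rewrite det_map_mx A0 rmorph0 det1 => /esym/eqP; rewrite oner_eq0.
move=> x; have [c ->] := gP x.
pose a l := \sum_j \sum_i c j * \adj A j i * co (g i) l.
exists a.
have adjA j : \det A *: g j = \sum_i \adj A j i *: \sum_l co (g i) l *: b l.
  transitivity (\sum_q (\adj A *m A) j q *: g q).
    rewrite mul_adj_mx (bigD1 j) //= mxE eqxx big1 ?addr0 // => q.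
    by rewrite eq_sym mxE => /negPf ->; rewrite scale0r.
  under eq_bigr => q _ do rewrite mxE scaler_suml.
  rewrite exchange_big; apply: eq_bigr => i _; rewrite -Ag scaler_sumr.
  by apply: eq_bigr => q _; rewrite scalerA.
rewrite scaler_sumr.
under eq_bigr => j _ do rewrite scalerA mulrC -scalerA adjA scaler_sumr.
under [RHS]eq_bigr => l _ do rewrite scaler_suml.
rewrite [RHS]exchange_big; apply: eq_bigr => j _.
under [RHS]eq_bigr => l _ do rewrite scaler_suml.
rewrite [RHS]exchange_big; apply: eq_bigr => i _; rewrite scalerA scaler_sumr.
by apply: eq_bigr => l _; rewrite scalerA.
Qed.
End Fiber.

(** * Dual modules and projectivity *)

Lemma triangle_exchange (V : nmodType) n (F : nat -> nat -> nat -> V) :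
  \sum_(i < n.+1) \sum_(j < (n - i).+1) F i j (n - i - j)%N =
  \sum_(j < n.+1) \sum_(i < (n - j).+1) F i j (n - j - i)%N.
Proof.
rewrite -!sum_triangle -(sum_triangle n (fun j i q => F i j q)).
apply: eq_bigr => k _; rewrite (reindex_inj rev_ord_inj) /=.
apply: eq_bigr => i _; rewrite subSS.
by rewrite subKn // -ltnS.
Qed.

Lemma alternating_binomial (A : comNzRingType) n :
  \sum_(j < n.+1) (-1) ^+ j *+ 'C(n, j) = (n == 0%N)%:R :> A.
Proof.
have := exprDn (1 : A) (-1) n; rewrite subrr expr0n => ->.
by apply: eq_bigr => j _; rewrite expr1n mul1r.
Qed.

Section Dual.
Variables (S : idRingType) (M : idModType S).
Implicit Types phi : M -> S.

(** As [mtheta 0] is the identity, the terms with [i = n] are [P n x] and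
    [Q n x]; the other terms agree by induction. *)
Lemma mtheta_convolution_inj (V : zmodType) (P Q : nat -> M -> V) :
  (forall n x, \sum_(i < n.+1) P i (mtheta (n - i) x) =
               \sum_(i < n.+1) Q i (mtheta (n - i) x)) ->
  forall n x, P n x = Q n x.
Proof.
move=> h; elim/ltn_ind => n IH x.
have := h n x; rewrite !big_ord_recr /= subnn mtheta0.
under eq_bigr => i _ do rewrite IH //.
by move/addrI.
Qed.

Lemma mtheta_sum n (I : Type) (r : seq I) (P : pred I) (F : I -> M) :
  mtheta n (\sum_(i <- r | P i) F i) = \sum_(i <- r | P i) mtheta n (F i).
Proof. exact: (big_morph (mtheta n) (mthetaD n) (mtheta_0 M n)). Qed.

(** The conjugate of [phi] by the automorphisms [theta] and [mtheta] of
    formal parameter [t].  The inverse of [mtheta] is obtained by the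
    substitution of [-t] for [t], whence the signs. *)
Definition dual_theta n phi (x : M) : S :=
  \sum_(j < n.+1) (-1) ^+ j * theta (n - j)%N (phi (mtheta j x)).

Lemma linear_formD phi : scalar phi -> forall x y, phi (x + y) = phi x + phi y.
Proof. by move=> h x y; rewrite -[x in LHS]scale1r h mul1r. Qed.
Lemma linear_form0 phi : scalar phi -> phi 0 = 0.
Proof.
by move=> h; apply: (addIr (phi 0)); rewrite -linear_formD // !add0r.
Qed.
Lemma linear_formZ phi : scalar phi -> forall a x, phi (a *: x) = a * phi x.
Proof. by move=> h a x; rewrite -[a *: x]addr0 h linear_form0 ?addr0. Qed.
Lemma linear_formMn phi : scalar phi -> forall x m, phi (x *+ m) = phi x *+ m.
Proof.
move=> h x; elim=> [|m IH]; first by rewrite !mulr0n linear_form0.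
by rewrite !mulrS linear_formD // IH.
Qed.
Lemma linear_form_sum phi : scalar phi ->
  forall (I : Type) (r : seq I) (F : I -> M),
  phi (\sum_(i <- r) F i) = \sum_(i <- r) phi (F i).
Proof.
by move=> h I r F; apply: (big_morph phi (linear_formD h) (linear_form0 h)).
Qed.

(** On the right, [phi] is preceded by [mtheta] at [-t] and at [t]; the
    composites [mtheta j (mtheta q x)] with [j + q] fixed and positive cancel
    because an alternating sum of binomial coefficients vanishes. *)
Lemma dual_leibniz phi : scalar phi -> forall n x,
  theta n (phi x) = \sum_(i < n.+1) dual_theta i phi (mtheta (n - i) x).
Proof.
move=> hphi n x.
pose F j p q := (-1) ^+ j * theta p (phi (mtheta j (mtheta q x))).
transitivity (\sum_(i < n.+1) \sum_(j < i.+1) F j (i - j)%N (n - i)%N) => //.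
rewrite sum_triangle triangle_exchange big_ord_recr /= subnn big_ord1 subn0.
rewrite big1 ?add0r => [|p _]; first by rewrite /F expr0 mul1r !mtheta0.
have np : (0 < n - p)%N by rewrite subn_gt0.
transitivity (\sum_(j < (n - p).+1)
    ((-1) ^+ j *+ 'C(n - p, j)) * theta p (phi (mtheta (n - p) x))).
  apply: eq_bigr => j _; rewrite /F mtheta_comp linear_formMn // thetaMn subnKC;
    last by rewrite -ltnS.
  by rewrite mulrnAr mulrnAl.
by rewrite -mulr_suml alternating_binomial eqn0Ngt np mul0r.
Qed.

(** The Leibniz rule gives two expansions of the derivative of
    [phi (a *: x) = a * phi x].  By induction they agree term by term except for
    [dual_theta n phi] itself, so they agree there too. *)
Lemma dual_theta_scalar phi : scalar phi -> forall n, scalar (dual_theta n phi).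
Proof.
move=> hphi; elim/ltn_ind => n IH a x y.
have addn u v :
    dual_theta n phi (u + v) = dual_theta n phi u + dual_theta n phi v.
  rewrite /dual_theta -big_split; apply: eq_bigr => j _ /=.
  by rewrite mthetaD linear_formD // thetaD mulrDr.
rewrite addn; congr (_ + _).
pose F i p q := theta p a * dual_theta i phi (mtheta q x).
have : \sum_(i < n.+1) \sum_(p < (n - i).+1)
    dual_theta i phi (theta p a *: mtheta (n - i - p) x) =
  \sum_(i < n.+1) \sum_(p < (n - i).+1) F i p (n - i - p)%N.
  transitivity (theta n (phi (a *: x))).
    rewrite dual_leibniz //; apply: eq_bigr => i _; rewrite mthetaZ.
    have := ltn_ord i; rewrite ltnS leq_eqVlt => /orP[/eqP ->|lin].
      by rewrite subnn !big_ord1.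
    by rewrite (linear_form_sum (IH i lin)).
  rewrite linear_formZ // thetaM triangle_exchange; apply: eq_bigr => p _.
  by rewrite dual_leibniz // mulr_sumr.
rewrite [LHS]big_ord_recr [RHS]big_ord_recr /= subnn !big_ord1 /F /= mtheta0 theta0.
rewrite [X in X + _ = _ -> _](_ : _ = \sum_(i < n)
  \sum_(p < (n - i).+1) F i p (n - i - p)%N); first by move/addrI.
apply: eq_bigr => i _; apply: eq_bigr => p _.
by rewrite (linear_formZ (IH i (ltn_ord i))).
Qed.

(** The endomorphisms coming from the tensor product of the dual of [M]
    with [M]. *)
Definition finite_rank (T : M -> M) : Prop :=
  exists (J : finType) (phi : J -> M -> S) (g : J -> M),
    (forall j, scalar (phi j)) /\ forall x, T x = \sum_j phi j x *: g j.

(** Deriving a tensor [sum_j phi_j (x) g_j] that represents multiplication by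
    [s] yields one that represents multiplication by [theta n s]; so the scalars
    of finite rank form an ID-ideal, and a nonzero one contains 1. *)
Lemma dual_basis : ID_simple S ->
  (exists2 s : S, s != 0 & finite_rank ( *:%R s)) ->
  exists (J : finType) (phi : J -> M -> S) (g : J -> M),
    (forall j, scalar (phi j)) /\ forall x, x = \sum_j phi j x *: g j.
Proof.
move=> hS [s s0 rk_s].
have [J [phi [g [hphi gP]]]] : finite_rank ( *:%R (1 : S)).
  apply: (@ID_simple_ideal1 S (fun s => finite_rank ( *:%R s)) hS _ _ _ s) => //.
  - exists 'I_0, (fun _ _ => 0), (fun=> 0); split=> [|x]; first by case.
    by rewrite big_ord0 scale0r.
  - move=> a u v [J [phi [g [hphi gP]]]] [J' [phi' [g' [hphi' gP']]]].
    exists (J + J')%type,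
      (fun j x => match j with inl j => a * phi j x | inr j => phi' j x end),
      (fun j => match j with inl j => g j | inr j => g' j end); split.
      by case=> j b x y; rewrite ?hphi ?hphi' // mulrDr mulrCA.
    move=> x; rewrite big_sumType /= scalerDl -scalerA gP gP' scaler_sumr.
    by congr (_ + _); apply: eq_bigr => j _; rewrite scalerA.
  - move=> n u [J [phi [g [hphi gP]]]].
    exists (J * 'I_n.+1)%type, (fun j : J * 'I_n.+1 => dual_theta j.2 (phi j.1)),
      (fun j : J * 'I_n.+1 => mtheta (n - j.2) (g j.1)).
    split=> [j|x]; first exact: dual_theta_scalar.
    pose E m (y : M) := \sum_j \sum_(i < m.+1)
      dual_theta i (phi j) y *: mtheta (m - i) (g j).
    rewrite -(pair_bigA _ (fun j (i : 'I_n.+1) =>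
      dual_theta i (phi j) x *: mtheta (n - i) (g j))) /= -/(E n x).
    have conv m y : \sum_(i < m.+1) theta i u *: mtheta (m - i) y =
                    \sum_(i < m.+1) E i (mtheta (m - i) y).
      rewrite -mthetaZ gP mtheta_sum exchange_big; apply: eq_bigr => j _ /=.
      pose F a p q := dual_theta a (phi j) (mtheta p y) *: mtheta q (g j).
      transitivity (\sum_(i < m.+1) \sum_(a < i.+1) F a (i - a)%N (m - i)%N).
        rewrite mthetaZ; apply: eq_bigr => i _.
        by rewrite dual_leibniz // scaler_suml.
      rewrite sum_triangle (sum_triangle m (fun a q p => F a p q)).
      apply: eq_bigr => a _; rewrite (reindex_inj rev_ord_inj) /=.
      by apply: eq_bigr => p _; rewrite subSS subKn // -ltnS.
    exact: (@mtheta_convolution_inj _ (fun i y => theta i u *: y) E conv n x).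
by exists J, phi, g; split=> // x; rewrite -gP scale1r.
Qed.

End Dual.

(** * Additive maps on the tensor product *)

Section CompIDMorphism.
Variables (A B C : idRingType) (g : idMorphism B C) (f : idMorphism A B).
Fact comp_theta_morph n a : (g \o f) (theta n a) = theta n ((g \o f) a).
Proof. by rewrite /= !theta_morph. Qed.
HB.instance Definition _ := isIDMorphism.Build A C (g \o f) comp_theta_morph.
End CompIDMorphism.

Section TensorLift.
Variables (S R A : idRingType) (f : idMorphism S R) (h : idMorphism R A).
Variables (M : idModType S) (u : M -> A).
Hypothesis uD : forall x y, u (x + y) = u x + u y.
Hypothesis uZ : forall c x, u (c *: x) = h (f c) * u x.

Definition tlift_seq (t : seq (R * M)) : A := \sum_(p <- t) h p.1 * u p.2.

Lemma tlift_seqP t t' : teq f t t' -> tlift_seq t = tlift_seq t'.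
Proof.
rewrite /tlift_seq; elim=> {t t'} //=.
- by move=> s t w _ -> _ ->.
- by move=> s s' t t' _ h1 _ h2; rewrite !big_cat /= h1 h2.
- by move=> s t; rewrite !big_cat /= addrC.
- by move=> m; rewrite big_seq1 big_nil /= rmorph0 mul0r.
- by move=> a b m; rewrite !big_cons big_nil /= !addr0 rmorphD mulrDl.
- by move=> a m m'; rewrite !big_cons big_nil /= !addr0 uD mulrDr.
- by move=> a c m; rewrite !big_seq1 /= rmorphM uZ mulrA.
Qed.

(** The map [a (x) m |-> h a * u m]. *)
Definition tlift (x : tensor f M) : A := tlift_seq (repr x).

Lemma tlift_class t : tlift (tclass f t) = tlift_seq t.
Proof. exact/tlift_seqP/repr_tclass. Qed.

Lemma tlift_pure a m : tlift (pure f a m) = h a * u m.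
Proof. by rewrite tlift_class /tlift_seq big_seq1. Qed.

Lemma tliftD x y : tlift (x + y) = tlift x + tlift y.
Proof.
have [s ->] := tensor_ind x; have [t ->] := tensor_ind y.
by rewrite {1}/GRing.add /= taddE !tlift_class /tlift_seq big_cat.
Qed.

Lemma tlift0 : tlift 0 = 0.
Proof. by apply: (addIr (tlift 0)); rewrite -tliftD !add0r. Qed.

Lemma tlift_sum (I : Type) (r : seq I) (F : I -> tensor f M) :
  tlift (\sum_(i <- r) F i) = \sum_(i <- r) tlift (F i).
Proof. exact: (big_morph tlift tliftD tlift0). Qed.

Lemma tliftZ a x : tlift (a *: x) = h a * tlift x.
Proof.
elim/ttheta_ind: x => [|x y IHx IHy|b m].
- by rewrite scaler0 tlift0 mulr0.
- by rewrite scalerDr !tliftD IHx IHy mulrDr.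
- by rewrite pureZ !tlift_pure rmorphM mulrA.
Qed.

Hypothesis u_theta : forall n x, theta n (u x) = u (mtheta n x).

Lemma tlift_theta n (x : tensor f M) : theta n (tlift x) = tlift (mtheta n x).
Proof.
change (theta n (tlift x) = tlift (ttheta n x)).
elim/ttheta_ind: x => [|x y IHx IHy|a m].
- by rewrite (ttheta_0 f M n) tlift0 theta_0.
- by rewrite (tthetaD n x y) !tliftD thetaD IHx IHy.
- rewrite (ttheta_pure f n a m) tlift_sum tlift_pure thetaM.
  by apply: eq_bigr => i _; rewrite tlift_pure -theta_morph u_theta.
Qed.
End TensorLift.

(** * The ring generated by the solutions *)

(** The [y i] are solutions of [M] in [k[[T]]], a full set of them as [Y] is
    invertible; up to the factor [s], the vectors [b] generate [M]. *)

Section Solutions.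
Variables (S : idRingType) (k : fieldType) (M : idModType S).
Local Notation L := (pseries k).
Variable f : idMorphism S L.
Hypothesis f_inj : injective f.
Variables (n : nat) (y : 'I_n -> M -> L) (b : 'I_n -> M) (s : S).
Hypothesis yD : forall i x x', y i (x + x') = y i x + y i x'.
Hypothesis yZ : forall i c x, y i (c *: x) = f c * y i x.
Hypothesis y_theta : forall i m x, theta m (y i x) = y i (mtheta m x).
Let Y := \matrix_(l, i) y i (b l).
Hypothesis Yunit : Y \in unitmx.
Hypothesis s0 : s != 0.
Hypothesis sM : forall x, exists a : 'I_n -> S, s *: x = \sum_l a l *: b l.

Let fs0 : f s != 0.
Proof. by rewrite -(rmorph0 f) (inj_eq f_inj). Qed.

Lemma sol0 i : y i 0 = 0.
Proof. by apply: (addIr (y i 0)); rewrite -yD !add0r. Qed.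
Lemma sol_sum i (J : Type) (r : seq J) (F : J -> M) :
  y i (\sum_(j <- r) F j) = \sum_(j <- r) y i (F j).
Proof. exact: (big_morph (y i) (yD i) (sol0 i)). Qed.

Lemma frame_inj m (X X' : 'M[L]_(m, n)) : X *m Y = X' *m Y -> X = X'.
Proof. by move=> h; rewrite -(mulmxK Yunit X) h mulmxK. Qed.
Lemma frame_injl m (X X' : 'M[L]_(n, m)) : Y *m X = Y *m X' -> X = X'.
Proof. by move=> h; rewrite -(mulKmx Yunit X) h mulKmx. Qed.

Definition frame_coord x : 'I_n -> S := projT1 (cid (sM x)).
Lemma frame_coordP x : s *: x = \sum_l frame_coord x l *: b l.
Proof. exact: (projT2 (cid (sM x))). Qed.

Lemma coord_sol x i : f s * y i x = \sum_l f (frame_coord x l) * y i (b l).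
Proof. by rewrite -yZ frame_coordP sol_sum; apply: eq_bigr => l _; rewrite yZ. Qed.

(** Coordinates are unique since [Y] is invertible and [f] injective. *)
Lemma coord_scalar l : scalar (fun x => frame_coord x l).
Proof.
move=> c x x'; apply: f_inj.
have : \row_l f (frame_coord (c *: x + x') l) =
       \row_l f (c * frame_coord x l + frame_coord x' l).
  apply: frame_inj; apply/rowP => i; rewrite !mxE.
  under eq_bigr => j _ do rewrite !mxE.
  under [RHS]eq_bigr => j _ do
    rewrite !mxE rmorphD rmorphM mulrDl -mulrA.
  by rewrite big_split -mulr_sumr /= -!coord_sol yD yZ mulrDr mulrCA.
by move/rowP/(_ l); rewrite !mxE.
Qed.

(** The value of [phi] at the constant vector [e_i = sum_l (Y^-1)_il b_l], for
    which [y_j(e_i)] is 1 if [i = j] and 0 otherwise. *)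
Definition dual_sol (phi : M -> S) i : L :=
  (invmx Y *m \col_l f (phi (b l))) i 0.

Lemma dual_solP phi w : (forall l, f (phi (b l)) = \sum_i y i (b l) * w i) ->
  forall i, dual_sol phi i = w i.
Proof.
move=> h i; have : invmx Y *m (\col_l f (phi (b l))) = \col_i w i.
  apply: frame_injl; rewrite mulKVmx //; apply/colP => l; rewrite !mxE h.
  by apply: eq_bigr => j _; rewrite !mxE.
by move/colP/(_ i); rewrite [RHS]mxE.
Qed.

(** The identity holds at the [b l] by definition of [dual_sol], and [s *: x] is
    a combination of these. *)
Lemma pairing phi x : scalar phi -> f (phi x) = \sum_i y i x * dual_sol phi i.
Proof.
move=> hphi; have hb l : f (phi (b l)) = \sum_i y i (b l) * dual_sol phi i.
  have /colP/(_ l) : Y *m (\col_i dual_sol phi i) = \col_l f (phi (b l)).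
    have -> : \col_i dual_sol phi i = invmx Y *m \col_l f (phi (b l)).
      by apply/colP => i; rewrite mxE.
    by rewrite mulKVmx.
  by rewrite !mxE => <-; apply: eq_bigr => i _; rewrite !mxE.
apply: (mulfI fs0); rewrite -rmorphM -(linear_formZ hphi) frame_coordP.
rewrite (linear_form_sum hphi) rmorph_sum mulr_sumr.
under eq_bigr => l _ do rewrite (linear_formZ hphi) rmorphM /= hb mulr_sumr.
rewrite exchange_big; apply: eq_bigr => i _ /=.
by rewrite mulrA coord_sol mulr_suml; apply: eq_bigr => l _; rewrite mulrA.
Qed.

(** Both the derivatives of [dual_sol phi] and the [dual_sol] of the derivatives
    of [phi] satisfy the identity obtained by deriving [pairing]. *)
Lemma dual_sol_theta phi i m : scalar phi ->
  theta m (dual_sol phi i) = dual_sol (dual_theta m phi) i.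
Proof.
move=> hphi; apply/esym.
pose P a x := \sum_i theta a (dual_sol phi i) * y i x.
pose Q a x := \sum_i dual_sol (dual_theta a phi) i * y i x.
have PQ : forall a x, P a x = Q a x.
  apply: mtheta_convolution_inj => {}m x.
  transitivity (theta m (f (phi x))).
    rewrite pairing // theta_sum exchange_big; apply: eq_bigr => j _ /=.
    by rewrite mulrC thetaM; apply: eq_bigr => a _; rewrite y_theta.
  rewrite -theta_morph dual_leibniz // rmorph_sum; apply: eq_bigr => a _ /=.
  rewrite pairing; last exact: dual_theta_scalar.
  by apply: eq_bigr => j _; rewrite mulrC.
apply: (dual_solP (w := fun i => theta m (dual_sol phi i))) => l.
rewrite pairing; last exact: dual_theta_scalar.
have := PQ m (b l); rewrite /P /Q.
under eq_bigr => j _ do rewrite mulrC.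
by under [RHS]eq_bigr => j _ do rewrite mulrC.
Qed.

Inductive generated : L -> Prop :=
| generated_base c : generated (f c)
| generated_sol i x : generated (y i x)
| generated_dual phi i : scalar phi -> generated (dual_sol phi i)
| generated_add u v : generated u -> generated v -> generated (u + v)
| generated_mul u v : generated u -> generated v -> generated (u * v).

Lemma generated_sum (J : Type) (r : seq J) (F : J -> L) :
  (forall j, generated (F j)) -> generated (\sum_(j <- r) F j).
Proof.
move=> h; elim/big_ind: _ => //; last exact: generated_add.
by rewrite -(rmorph0 f); apply: generated_base.
Qed.

Lemma generated_theta m u : generated u -> generated (theta m u).
Proof.
move=> gu; elim: gu m => {u} [c|i x|phi i hphi|u v _ IHu _ IHv|u v _ IHu _ IHv] m.
- by rewrite -theta_morph; apply: generated_base.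
- by rewrite y_theta; apply: generated_sol.
- by rewrite dual_sol_theta //; apply/generated_dual/dual_theta_scalar.
- by rewrite thetaD; apply: generated_add.
- by rewrite thetaM; apply: generated_sum => j; apply: generated_mul.
Qed.

Definition PV_pred : L -> bool := fun u => `[< generated u >].
Lemma PV_predP u : u \in PV_pred <-> generated u.
Proof. by split=> /asboolP. Qed.
Fact PV_subring : subring_closed PV_pred.
Proof.
split=> [|u v /PV_predP gu /PV_predP gv|u v /PV_predP gu /PV_predP gv].
- by apply/PV_predP; rewrite -(rmorph1 f); apply: generated_base.
- apply/PV_predP/generated_add => //; rewrite -mulN1r -(rmorphN1 f).
  by apply: generated_mul => //; apply: generated_base.
- by apply/PV_predP/generated_mul.
Qed.
HB.instance Definition _ := GRing.isSubringClosed.Build L PV_pred PV_subring.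
Fact PV_theta m u : u \in PV_pred -> theta m u \in PV_pred.
Proof. by move=> /PV_predP gu; apply/PV_predP/generated_theta. Qed.
HB.instance Definition _ := isThetaStable.Build L PV_pred PV_theta.

Definition PV_ring : idRingType := subID (PV_pred : idSubring L).
Fact PV_base c : f c \in PV_pred.
Proof. exact/PV_predP/generated_base. Qed.
Definition PV_mor : idMorphism S PV_ring :=
  corestrict (P := PV_pred : idSubring L) PV_base.

(** [r] is a constant combination of the entries of a vector [v] whose
    derivatives all lie, up to the factor [d], in the [S]-span of the rows of
    [B]; and [B] is invertible up to [d] over the generated ring.  This holds
    for the coordinates of an element of an ID-module that becomes trivial over
    the generated ring, [B] being the values of its solutions on elements that
    form a basis after [d] is inverted.  Direct sums of such modules correspond
    to block matrices and tensor products to Kronecker products, so that the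
    condition is inherited by sums and products of elements. *)
Definition framed (r : L) : Prop :=
  exists (J : finType) (v : J -> L) (B rho : J -> J -> L) (d : S) (c : J -> k),
  [/\ d != 0,
      forall m, exists a : J -> S, forall i,
        f d * theta m (v i) = \sum_p f (a p) * B p i,
      forall i j, f d *+ (i == j) = \sum_p rho i p * B p j,
      forall i j, generated (rho i j)
    & r = \sum_i v i * psC (c i)].

Lemma framed_base c : framed (f c).
Proof.
exists 'I_1, (fun=> f c), (fun _ _ => 1), (fun _ _ => 1), 1, (fun=> 1); split.
- exact: oner_neq0.
- move=> m; exists (fun=> theta m c) => i.
  by rewrite big_ord1 mulr1 theta_morph rmorph1 mul1r.
- by move=> i j; rewrite !ord1 eqxx big_ord1 mulr1 rmorph1.
- by move=> i j; rewrite -(rmorph1 f); apply: generated_base.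
- by rewrite big_ord1 rmorph1 mulr1.
Qed.

Definition dual_frame : 'M[L]_n :=
  \matrix_(i, p) dual_sol (fun x => frame_coord x p) i.

Lemma mul_frame_dual : Y *m dual_frame = (f s)%:M.
Proof.
apply/matrixP => j p; rewrite !mxE.
have := pairing (b j) (coord_scalar p).
under [X in _ -> X = _]eq_bigr => q _ do rewrite !mxE.
move=> <-.
have : \row_p f (frame_coord (b j) p) = f s *: delta_mx 0 j.
  apply: frame_inj; apply/rowP => q; rewrite !mxE.
  under eq_bigr => t _ do rewrite !mxE.
  rewrite -coord_sol (bigD1 j) //= !mxE !eqxx mulr1 big1 ?addr0 // => t.
  by move=> /negPf tj; rewrite !mxE tj andbF mulr0 mul0r.
by move/rowP/(_ p); rewrite !mxE eq_sym => ->; rewrite mulr_natr.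
Qed.

Lemma mul_dual_frame : dual_frame *m Y = (f s)%:M.
Proof.
by apply: frame_injl; rewrite mulmxA mul_frame_dual mul_scalar_mx mul_mx_scalar.
Qed.

Lemma frame_dual i l :
  \sum_p dual_sol (fun x => frame_coord x p) i * y l (b p) = f s *+ (i == l).
Proof.
have /matrixP/(_ i l) := mul_dual_frame; rewrite !mxE => <-.
by apply: eq_bigr => p _; rewrite !mxE.
Qed.

Lemma coord_dual_sol phi i :
  f s * dual_sol phi i =
  \sum_p f (phi (b p)) * dual_sol (fun x => frame_coord x p) i.
Proof.
have : f s *: (invmx Y *m \col_l f (phi (b l))) =
    dual_frame *m \col_l f (phi (b l)).
  apply: frame_injl; rewrite mulmxA mul_frame_dual -scalemxAr mulKVmx //.
  by rewrite mul_scalar_mx.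
move/colP/(_ i); rewrite [LHS]mxE /dual_sol => ->; rewrite mxE.
by apply: eq_bigr => p _; rewrite [dual_frame i p]mxE [X in _ * X]mxE mulrC.
Qed.

Lemma sum_pick (J : finType) (i : J) (v : J -> L) :
  v i = \sum_j v j * psC (j == i)%:R.
Proof.
rewrite (bigD1 i) //= eqxx rmorph1 mulr1 big1 ?addr0 // => j /negPf ->.
by rewrite rmorph0 mulr0.
Qed.

Lemma framed_sol i x : framed (y i x).
Proof.
exists 'I_n, (fun j => y j x), (fun p j => y j (b p)),
  (fun j p => dual_sol (fun x => frame_coord x p) j), s, (fun j => (j == i)%:R).
split=> //; last exact: (sum_pick i (fun j => y j x)).
- by move=> m; exists (frame_coord (mtheta m x)) => j; rewrite y_theta coord_sol.
- by move=> j l; rewrite frame_dual.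
- by move=> j p; apply/generated_dual/coord_scalar.
Qed.

Lemma framed_dual phi i : scalar phi -> framed (dual_sol phi i).
Proof.
move=> hphi.
exists 'I_n, (dual_sol phi), (fun p => dual_sol (fun x => frame_coord x p)),
  (fun j p => y j (b p)), s, (fun j => (j == i)%:R).
split=> //; last exact: (sum_pick i (dual_sol phi)).
- move=> m; exists (fun p => dual_theta m phi (b p)) => j.
  by rewrite dual_sol_theta // coord_dual_sol.
- move=> j l; rewrite eq_sym -frame_dual.
  by apply: eq_bigr => p _; rewrite mulrC.
- by move=> j p; apply: generated_sol.
Qed.

Lemma generatedZ d u : generated u -> generated (f d * u).
Proof. by apply: generated_mul; apply: generated_base. Qed.

Let generated0 : generated 0.
Proof. by rewrite -(rmorph0 f); apply: generated_base. Qed.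

Let mulS_neq0 (d d' : S) : d != 0 -> d' != 0 -> d * d' != 0.
Proof.
move=> d0 d'0; rewrite -(inj_eq f_inj) rmorph0 rmorphM mulf_neq0 //.
  by rewrite -(rmorph0 f) (inj_eq f_inj).
by rewrite -(rmorph0 f) (inj_eq f_inj).
Qed.

Lemma framed_add u u' : framed u -> framed u' -> framed (u + u').
Proof.
move=> [J [v [B [rho [d [c [d0 hv hB hrho ->]]]]]]].
move=> [J' [v' [B' [rho' [d' [c' [d'0 hv' hB' hrho' ->]]]]]]].
exists (J + J')%type, (fun j => match j with inl j => v j | inr j => v' j end),
 (fun i j => match i, j with inl i, inl j => B i j | inr i, inr j => B' i j
             | _, _ => 0 end),
 (fun i j => match i, j with inl i, inl j => f d' * rho i j
             | inr i, inr j => f d * rho' i j | _, _ => 0 end),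
 (d * d'), (fun j => match j with inl j => c j | inr j => c' j end).
split; first exact: mulS_neq0.
- move=> m; have [a ha] := hv m; have [a' ha'] := hv' m.
  exists (fun j => match j with inl j => d' * a j | inr j => d * a' j end).
  case=> i; rewrite big_sumType /= rmorphM.
  + rewrite [X in _ + X]big1 ?addr0 => [|j _]; last by rewrite mulr0.
    rewrite mulrAC ha mulr_suml; apply: eq_bigr => j _.
    by rewrite mulrC mulrA rmorphM.
  + rewrite [X in X + _]big1 ?add0r => [|j _]; last by rewrite mulr0.
    rewrite -mulrA ha' mulr_sumr; apply: eq_bigr => j _.
    by rewrite rmorphM mulrA.
- case=> i [] j; rewrite big_sumType /= rmorphM.
  + rewrite [X in _ + X]big1 ?addr0 => [|p _]; last by rewrite mulr0.
    rewrite -[inl i == inl j]/(i == j) mulrC -mulrnAr hB mulr_sumr.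
    by apply: eq_bigr => p _; rewrite mulrA.
  + by rewrite !big1 ?addr0 // => p _; rewrite ?mulr0 ?mul0r.
  + by rewrite !big1 ?addr0 // => p _; rewrite ?mulr0 ?mul0r.
  + rewrite [X in X + _]big1 ?add0r => [|p _]; last by rewrite mulr0.
    rewrite -[inr i == inr j]/(i == j) -mulrnAr hB' mulr_sumr.
    by apply: eq_bigr => p _; rewrite mulrA.
- by case=> i [] j //; apply: generatedZ.
- by rewrite big_sumType.
Qed.

Lemma framed_mul u u' : framed u -> framed u' -> framed (u * u').
Proof.
move=> [J [v [B [rho [d [c [d0 hv hB hrho ->]]]]]]].
move=> [J' [v' [B' [rho' [d' [c' [d'0 hv' hB' hrho' ->]]]]]]].
exists (J * J')%type, (fun j => v j.1 * v' j.2),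
 (fun i j => B i.1 j.1 * B' i.2 j.2),
 (fun i j => rho i.1 j.1 * rho' i.2 j.2),
 (d * d'), (fun j => c j.1 * c' j.2).
split; first exact: mulS_neq0.
- move=> m; have [a ha] := choice hv; have [a' ha'] := choice hv'.
  exists (fun p => \sum_(l < m.+1) a l p.1 * a' (m - l)%N p.2) => -[i i'] /=.
  rewrite thetaM rmorphM mulr_sumr.
  under [RHS]eq_bigr => p _ do rewrite rmorph_sum mulr_suml.
  rewrite exchange_big; apply: eq_bigr => l _ /=.
  rewrite mulrACA ha ha' big_distrlr /= pair_bigA.
  by apply: eq_bigr => p _; rewrite /= rmorphM mulrACA.
- move=> [i i'] [j j'] /=.
  rewrite -(pair_bigA _ (fun p p' => rho i p * rho' i' p' * (B p j * B' p' j'))) /=.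
  under eq_bigr => p _ do under eq_bigr => p' _ do rewrite mulrACA.
  rewrite -big_distrlr /= -hB -hB' rmorphM xpair_eqE.
  by case: (i == j); case: (i' == j'); rewrite ?mulr0n ?mulr1n ?mulr0 ?mul0r.
- by move=> i j; apply: generated_mul.
- rewrite big_distrlr pair_bigA; apply: eq_bigr => p _ /=.
  by rewrite rmorphM mulrACA.
Qed.

Lemma generated_framed u : generated u -> framed u.
Proof.
elim=> {u} [c|i x|phi i hphi|u v _ tu _ tv|u v _ tu _ tv].
- exact: framed_base.
- exact: framed_sol.
- exact: framed_dual.
- exact: framed_add.
- exact: framed_mul.
Qed.

Hypothesis const_surj : forall c : k, exists2 t : S, ID_constant t & f t = psC c.

Lemma generated_const c : generated (psC c).
Proof. by have [t _ <-] := const_surj c; apply: generated_base. Qed.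

Lemma sum_enum_val (V : nmodType) (J : finType) (F : J -> V) :
  \sum_j F j = \sum_(i < #|J|) F (enum_val i).
Proof. exact: (reindex _ (onW_bij _ (enum_val_bij J))). Qed.

Hypothesis hS : ID_simple S.

(** By [contraction_neq0] a nonzero ID-ideal has a nonzero contraction to [S],
    which is an ID-ideal, so that it contains 1. *)
Lemma PV_ring_simple : ID_simple PV_ring.
Proof.
move=> I hI r rI; apply/eqP/negPn/negP => r0.
pose I' (u : L) := exists2 t : PV_ring, t \in I & subID_val t = u.
have [J [v [B [rho [d [c [d0 hv hB hrho rE]]]]]]] :=
  generated_framed ((PV_predP _).1 (valP r)).
have [e e0 [t tI te]] : exists2 e, e != 0 & I' (f e).
  have addI u w : I' u -> I' w -> I' (u + w).
    by move=> [t tI <-] [t' tI' <-]; exists (t + t'); rewrite ?rmorphD ?rpredD.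
  have mulI u w : u \in PV_pred -> I' w -> I' (u * w).
    move=> uP [t tI <-]; exists (Sub u uP * t); first exact: idealMr.
    by rewrite rmorphM.
  have thetaI m u : I' u -> I' (theta m u).
    by move=> [t tI <-]; exists (theta m t); [apply: hI|rewrite theta_morph].
  have I0 : I' 0 by exists 0; rewrite ?idealr0 ?rmorph0.
  have constP c' : psC c' \in PV_pred by apply/PV_predP/generated_const.
  pose vm := \row_i v (@enum_val J predT i).
  pose cm := \col_i c (@enum_val J predT i).
  have rE' : (vm *m map_mx (@psC k) cm) 0 0 = val r.
    rewrite rE sum_enum_val mxE; apply: eq_bigr => i _; by rewrite !mxE.
  apply: (contraction_neq0 f_inj PV_base constP I0 addI mulI thetaI
    (v := vm) (B := \matrix_(i, j) B (enum_val i) (enum_val j))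
    (rho := \matrix_(i, j) rho (enum_val i) (enum_val j)) (l := cm) d0).
  - move=> m; have [a ha] := hv m; exists (\row_i a (enum_val i)).
    apply/rowP => i; rewrite !mxE ha sum_enum_val.
    by apply: eq_bigr => p _; rewrite !mxE.
  - apply/matrixP => i j; rewrite !mxE -(inj_eq enum_val_inj) hB sum_enum_val.
    by apply: eq_bigr => p _; rewrite !mxE.
  - by move=> i j; rewrite mxE; apply/PV_predP.
  - by rewrite rE'; exists r.
  - by rewrite rE'; apply: contra r0 => /eqP h; apply/eqP/val_inj.
have tE : t = PV_mor e by apply: val_inj.
have : (1 : PV_ring) \in I.
  have <- : PV_mor 1 = 1 by apply: rmorph1.
  apply: (@ID_simple_ideal1 S (fun x => PV_mor x \in I) hS _ _ _ e) => //.
  - by rewrite rmorph0 idealr0.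
  - by move=> a u w uI wI; rewrite rmorphD rmorphM rpredD // idealMr.
  - by move=> m u uI; rewrite theta_morph hI.
  - by rewrite -tE.
by rewrite idealr1.
Qed.

(** The constants of [k[[T]]] are the elements of [k], and these come from the
    constants of [S]. *)
Lemma PV_ring_constant (r : PV_ring) :
  ID_constant r <-> exists2 c : S, ID_constant c & PV_mor c = r.
Proof.
split=> [hr|[c hc <-] m]; last first.
  by rewrite -theta_morph hc; case: eqP => // _; rewrite rmorph0.
have /ps_constantP rE : ID_constant (subID_val r).
  by move=> m; rewrite -theta_morph hr; case: eqP => // _; rewrite rmorph0.
have [t ht tE] := const_surj (subID_val r 0%N).
by exists t => //; apply: val_inj; rewrite -[LHS]/(f t) tE -rE.
Qed.

Variables (J : finType) (phi : J -> M -> S) (g : J -> M).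
Hypothesis phi_scalar : forall j, scalar (phi j).
Hypothesis phi_g : forall x, x = \sum_j phi j x *: g j.

(** Both sides become [Y] when [Y] is multiplied by them. *)
Lemma dual_basis_sol i l :
  \sum_j dual_sol (phi j) i * y l (g j) = (i == l)%:R.
Proof.
have : (\matrix_(i, l) \sum_j dual_sol (phi j) i * y l (g j)) = 1%:M :> 'M[L]_n.
  apply: frame_injl; rewrite mulmx1; apply/matrixP => p q; rewrite !mxE.
  rewrite [in RHS](phi_g (b p)) sol_sum.
  under [RHS]eq_bigr => j _ do rewrite yZ pairing // mulr_suml.
  rewrite exchange_big; apply: eq_bigr => a _ /=; rewrite !mxE mulr_sumr.
  by apply: eq_bigr => j _; rewrite mulrA.
by move/matrixP/(_ i l); rewrite !mxE.
Qed.

Lemma PV_lift u : generated u -> exists r : PV_ring, subID_val r = u.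
Proof. by move=> /PV_predP gu; exists (Sub u gu). Qed.

Lemma PV_morK t : subID_val (PV_mor t) = f t.
Proof. by []. Qed.

(** The basis is [e i = sum_j z_i(phi_j) (x) g_j], with coordinates [Lam l], the
    extension of [y l] to the tensor product.  It spans by the dual basis
    property.  As the [Lam l] commute with the derivations and take constant
    values at [e i], the derivatives of [e i] vanish. *)
Lemma PV_ring_trivial : ID_trivial (tensor PV_mor M : idModType PV_ring).
Proof.
have /choice[zR zRE] : forall p : J * 'I_n, exists r : PV_ring,
    subID_val r = dual_sol (phi p.1) p.2.
  by move=> p; apply/PV_lift/generated_dual.
have /choice[yR yRE] : forall p : 'I_n * M, exists r : PV_ring,
    subID_val r = y p.1 p.2.
  by move=> p; apply/PV_lift/generated_sol.
pose e i : tensor PV_mor M := \sum_j pure PV_mor (zR (j, i)) (g j).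
pose Lam l : tensor PV_mor M -> L := tlift (@subID_val L PV_pred) (y l).
have LamE i l : Lam l (e i) = (i == l)%:R.
  rewrite /Lam tlift_sum // -dual_basis_sol; apply: eq_bigr => j _.
  by rewrite tlift_pure //= zRE.
have Lam_comb l (c : 'I_n -> PV_ring) :
    Lam l (\sum_i c i *: e i) = subID_val (c l).
  rewrite /Lam tlift_sum // (bigD1 l) //= big1 => [|i /negPf il].
    by rewrite tliftZ // [tlift _ _ _]LamE eqxx mulr1 addr0.
  by rewrite tliftZ // [tlift _ _ _]LamE il mulr0.
have span x : exists c : 'I_n -> PV_ring, x = \sum_i c i *: e i.
  elim/ttheta_ind: x => [|x x' [c ->] [c' ->]|a m].
  - by exists (fun=> 0); rewrite big1 // => i _; rewrite scale0r.
  - exists (fun i => c i + c' i); rewrite -big_split /=.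
    by apply: eq_bigr => i _; rewrite scalerDl.
  - exists (fun i => a * yR (i, m)).
    rewrite [in LHS](phi_g m) pure_sumr.
    under [RHS]eq_bigr => i _ do rewrite scaler_sumr.
    rewrite exchange_big; apply: eq_bigr => j _ /=.
    under eq_bigr => i _ do rewrite pureZ.
    rewrite -pureM -pure_suml; congr (pure PV_mor _ _).
    apply: (val_inj : injective (@subID_val L PV_pred)).
    rewrite rmorphM rmorph_sum /= PV_morK pairing // mulr_sumr.
    by apply: eq_bigr => i _; rewrite !rmorphM /= yRE zRE mulrA.
exists n, e; split=> [x|i m].
  have [c xE] := span x; exists [ffun i => c i]; split=> [|c' xE'].
    by rewrite xE; apply: eq_bigr => i _; rewrite ffunE.
  apply/ffunP => i; apply: val_inj; rewrite ffunE.
  by have := Lam_comb i c; rewrite -xE xE' Lam_comb => h; exact: esym h.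
case: m => [|m]; first exact: mtheta0.
have [c cE] := span (mtheta m.+1 (e i)); rewrite cE big1 // => l _.
suff -> : c l = 0 by rewrite scale0r.
apply: val_inj; have := Lam_comb l c; rewrite -cE /Lam -tlift_theta //.
rewrite [tlift _ _ _]LamE => h; apply: (etrans (esym h)).
by case: (i == l); rewrite ?theta1 ?theta_0.
Qed.

(** Let [e'] be a constant basis over [R'].  The extension [Lam l] of [y l]
    takes constant values [beta] on [e'], and the coordinates [c'] of the elements of
    [M] satisfy [y = c' beta]; this puts [y] in the image of [R'].  Likewise the
    values [Lam' psi] at [e'] of a linear form [psi] of [M] lie in the image and
    equal [beta z(psi)].  Now [beta] has a left inverse [Gam], because [c' beta]
    is invertible at the [b l]; since [beta] is constant, the constant terms
    of such an inverse form one as well.  So [z(psi) = Gam Lam' psi] is in the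
    image too. *)
Lemma PV_ring_minimal (R' : idRingType) (f' : idMorphism S R') :
  solution_ring M f' ->
  forall h : idMorphism R' PV_ring, (forall t, h (f' t) = PV_mor t) ->
  bijective h.
Proof.
move=> [R'simple _ [N [e' [e'_basis e'_const]]]] h hf.
have [h' h'E] : exists h' : idMorphism R' L, forall r, h' r = subID_val (h r).
  by exists ((@subID_val L PV_pred) \o h).
have h'f t : h' (f' t) = f t by rewrite h'E hf.
pose range (u : L) := exists r, h' r = u.
have rangeD u v : range u -> range v -> range (u + v).
  by move=> [a <-] [c <-]; exists (a + c); rewrite rmorphD.
have rangeM u v : range u -> range v -> range (u * v).
  by move=> [a <-] [c <-]; exists (a * c); rewrite rmorphM.
have range_base t : range (f t) by exists (f' t); apply: h'f.
have range_const c : range (psC c).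
  by have [t _ <-] := const_surj c; apply: range_base.
have range_sum (I : finType) (F : I -> L) :
    (forall i, range (F i)) -> range (\sum_i F i).
  move=> hF; apply: (big_ind range); [|exact: rangeD|by move=> i _].
  by rewrite -(rmorph0 f); apply: range_base.
have yZ' l c x : y l (c *: x) = h' (f' c) * y l x by rewrite yZ h'f.
pose Lam l : tensor f' M -> L := tlift h' (y l).
pose Lam' (psi : M -> S) : tensor f' M -> L := tlift h' (fun x => f (psi x)).
have psiD (psi : M -> S) : scalar psi ->
    forall x x', f (psi (x + x')) = f (psi x) + f (psi x').
  by move=> hpsi x x'; rewrite (linear_formD hpsi) rmorphD.
have psiZ (psi : M -> S) : scalar psi ->
    forall c x, f (psi (c *: x)) = h' (f' c) * f (psi x).
  by move=> hpsi c x; rewrite (linear_formZ hpsi) rmorphM h'f.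
have beta_const i l : exists c, Lam l (e' i) = psC c.
  exists (Lam l (e' i) 0%N); apply/ps_constantP => m.
  rewrite /Lam tlift_theta // e'_const; case: eqP => // _.
  by rewrite tlift0.
have Lam'E (psi : M -> S) x : scalar psi ->
    Lam' psi x = \sum_l Lam l x * dual_sol psi l.
  move=> hpsi; elim/ttheta_ind: x => [|x x' IH IH'|a m].
  - rewrite /Lam' tlift0; [|exact: psiD|exact: psiZ].
    by rewrite big1 // => l _; rewrite /Lam tlift0 // mul0r.
  - rewrite /Lam' tliftD; [|exact: psiD|exact: psiZ].
    rewrite [tlift _ _ x]IH [tlift _ _ x']IH' -big_split.
    by apply: eq_bigr => l _; rewrite /Lam tliftD // mulrDl.
  - rewrite /Lam' tlift_pure; [|exact: psiD|exact: psiZ].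
    rewrite pairing // mulr_sumr; apply: eq_bigr => l _.
    by rewrite /Lam tlift_pure // mulrA.
have Lam'_range (psi : M -> S) x : scalar psi -> range (Lam' psi x).
  move=> hpsi; elim/ttheta_ind: x => [|x x' IH IH'|a m].
  - rewrite /Lam' tlift0; [|exact: psiD|exact: psiZ].
    by rewrite -(rmorph0 f); apply: range_base.
  - by rewrite /Lam' tliftD; [apply: rangeD|exact: psiD|exact: psiZ].
  - rewrite /Lam' tlift_pure; [|exact: psiD|exact: psiZ].
    by apply: rangeM => //; exists a.
have /choice[c' c'E] : forall x : M, exists c : {ffun 'I_N -> R'},
    pure f' 1 x = \sum_i c i *: e' i.
  by move=> x; have [c [cE _]] := e'_basis (pure f' 1 x); exists c.
have yE l x : y l x = \sum_i h' (c' x i) * Lam l (e' i).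
  rewrite -[LHS]mul1r -(rmorph1 h') -(tlift_pure (yD l) (yZ' l)) c'E.
  by rewrite tlift_sum //; apply: eq_bigr => i _; rewrite tliftZ.
have range_sol l x : range (y l x).
  rewrite yE; apply: range_sum => i; apply: rangeM; first by exists (c' x i).
  by have [c ->] := beta_const i l.
pose beta := \matrix_(i, l) Lam l (e' i).
pose C' := \matrix_(p, i) h' (c' (b p) i).
have Ybeta : Y = C' *m beta.
  apply/matrixP => p l; rewrite !mxE yE; apply: eq_bigr => i _.
  by rewrite !mxE.
pose coef0 m q := @map_mx L k (@ps_coef0 k) m q.
have betaE : beta = map_mx (@psC k) (coef0 _ _ beta).
  apply/matrixP => i l; rewrite !mxE; have [c ->] := beta_const i l.
  by [].
pose Gam := coef0 _ _ (invmx Y *m C').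
have Gbeta : map_mx (@psC k) Gam *m beta = 1%:M.
  rewrite betaE -map_mxM -map_mxM -mulmxA -Ybeta mulVmx //.
  by rewrite !map_scalar_mx !rmorph1.
have range_dual (psi : M -> S) l : scalar psi -> range (dual_sol psi l).
  move=> hpsi.
  have -> : dual_sol psi l = \sum_i psC (Gam l i) * Lam' psi (e' i).
    have : map_mx (@psC k) Gam *m (\col_i Lam' psi (e' i)) = \col_l dual_sol psi l.
      rewrite -[RHS]mul1mx -Gbeta -mulmxA; congr (_ *m _).
      apply/colP => i; rewrite !mxE Lam'E //.
      by apply: eq_bigr => q _; rewrite !mxE.
    move/colP/(_ l); rewrite [RHS]mxE => <-; rewrite mxE.
    by apply: eq_bigr => i _; rewrite !mxE.
  by apply: range_sum => i; apply: rangeM => //; apply: Lam'_range.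
have range_generated u : generated u -> range u.
  elim=> {u} [c|i x|psi i hpsi|u v _ ru _ rv|u v _ ru _ rv].
  - exact: range_base.
  - exact: range_sol.
  - exact: range_dual.
  - exact: rangeD.
  - exact: rangeM.
have /choice[hinv hinvE] : forall u : PV_ring, exists r, h r = u.
  move=> u; have [r rE] := range_generated _ ((PV_predP _).1 (valP u)).
  by exists r; apply: val_inj; rewrite -rE h'E.
exists hinv => // r; apply: (ID_simple_inj (g := h) R'simple).
exact: hinvE.
Qed.
End Solutions.

(** * Existence of Picard-Vessiot rings *)

Section Existence.
Variables (S : idRingType) (k : fieldType) (eps : {rmorphism S -> k}).
Hypothesis hS : ID_simple S.
Hypothesis eps_const : forall x : k, exists2 c : S, ID_constant c & eps c = x.

(** The solutions are the Taylor series [y i x] of the fibre coordinates of [x];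
    their matrix on [b] has constant term 1. *)
Lemma Picard_Vessiot_exists (M : idModType S) :
  exists (R : idRingType) (f : idMorphism S R), Picard_Vessiot M f.
Proof.
pose L := pseries k.
pose f : idMorphism S L := taylor eps.
have f_inj : injective f := ID_simple_inj hS.
have const_surj c : exists2 t : S, ID_constant t & f t = psC c.
  have [t ht <-] := eps_const c; exists t => //; exact: taylor_constant.
have eps_surj x : exists c, eps c = x by have [c _ <-] := eps_const x; exists c.
have [n [b [lam [lamD lamZ lam_b [s s0 sM]]]]] := fiber_basis M eps_surj.
pose y i x : L := fun p => lam (mtheta p x) i.
have yD i x x' : y i (x + x') = y i x + y i x'.
  by apply: ps_ext => p; rewrite psDE /y mthetaD lamD.
have lam_sum i (I : Type) (r : seq I) (F : I -> M) :
    lam (\sum_(j <- r) F j) i = \sum_(j <- r) lam (F j) i.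
  apply: (big_morph (lam^~ i)) => [x x'|]; first exact: lamD.
  by apply: (addIr (lam 0 i)); rewrite -lamD !add0r.
have yZ i c x : y i (c *: x) = f c * y i x.
  apply: ps_ext => p; rewrite psME /y mthetaZ lam_sum.
  by apply: eq_bigr => j _; rewrite lamZ.
have y_theta i p x : theta p (y i x) = y i (mtheta p x).
  apply: ps_ext => q; rewrite ps_thetaE /y mtheta_comp.
  rewrite [(q + p)%N]addnC -[in RHS](bin_sub (leq_addl p q)) addnK.
  by rewrite -!scaler_nat lamZ rmorph_nat mulr_natl.
have Yunit : \matrix_(l, i) y i (b l) \in unitmx.
  rewrite unitmxE ps_unitE //.
  rewrite -[X in X != 0]/(ps_coef0 _) -det_map_mx.
  have -> : map_mx (@ps_coef0 k) (\matrix_(l, i) y i (b l)) = 1%:M.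
    by apply/matrixP => l i; rewrite !mxE /ps_coef0 /y mtheta0 lam_b.
  by rewrite det1 oner_neq0.
have rk : exists2 s : S, s != 0 & finite_rank (M := M) ( *:%R s).
  exists s => //; exists 'I_n, (fun l x => frame_coord sM x l), b; split=> [l|x].
    exact: (coord_scalar f_inj yD yZ Yunit).
  exact: frame_coordP.
have [J [phi [g [phi_scalar phi_g]]]] := dual_basis hS rk.
pose f' := PV_mor f_inj yD yZ y_theta Yunit s0 sM.
exists (PV_ring f_inj yD yZ y_theta Yunit s0 sM), f'; split.
  split.
  - exact: PV_ring_simple.
  - exact: PV_ring_constant.
  - exact: (PV_ring_trivial f_inj yD yZ y_theta Yunit s0 sM phi_scalar phi_g).
move=> R' f'' sol; apply: PV_ring_minimal => //.
Qed.
End Existence.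

Theorem theorem5p7 (S : idRingType) (hS : ID_simple S)
  (m : idealr S) (hm : maximal_ideal m)
  (hC : bijective (fun c : {c : S | ID_constant c} =>
                     \pi_{ideal_quot m} (proj1_sig c)))
  (M : idModType S) :
  exists (R : idRingType) (f : idMorphism S R), Picard_Vessiot M f.
Proof.
pose p : {rmorphism S -> {ideal_quot m}} := \pi_{ideal_quot m}.
have p0E a : (p a == 0) = (a \in m).
  by rewrite -[a in RHS]subr0 Quotient.idealrBE -[0 in LHS](rmorph0 p).
have pK x : exists a, p a = x by exists (repr x); apply: reprK.
have mulV (x : {ideal_quot m}) : exists z, (x != 0 -> z * x = 1) /\ (x = 0 -> z = 0).
  have [->|x0] := eqVneq x 0; first by exists 0; split=> // /eqP.
  have [a ax] := pK x; have am : a \notin m by rewrite -p0E ax.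
  pose Q u := exists t v, v \in m /\ u = t * a + v.
  (* [Q] is the ideal generated by [m] and [a]. *)
  have [[t [v [vm tav]]]|Q1] := pselect (Q 1).
    exists (p t); split=> [_|/eqP]; last by rewrite (negPf x0).
    move: vm; rewrite -p0E => /eqP pv0.
    by rewrite -ax -rmorphM -(rmorph1 p) tav rmorphD /= pv0 addr0.
  have [||J JE] := @ideal_of_predicate S Q _ Q1.
  - by exists 0, 0; rewrite mul0r addr0 idealr0.
  - move=> c u w [t [v [vm ->]]] [t' [v' [vm' ->]]].
    exists (c * t + t'), (c * v + v'); split; first by rewrite rpredD // idealMr.
    by rewrite mulrDr mulrDl !mulrA addrACA.
  case/negP: am; apply: (hm J) => [v vm|]; apply/JE.
    by exists 0, v; rewrite mul0r add0r.
  by exists 1, 0; rewrite mul1r addr0 idealr0.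
have [inv invP] := choice mulV.
pose K : fieldType := HB.pack {ideal_quot m}
  (GRing.ComNzRing_isField.Build {ideal_quot m}
     (fun x => (invP x).1) ((invP 0).2 erefl)).
pose eps : {rmorphism S -> K} := p.
apply: (@Picard_Vessiot_exists S K eps hS) => x.
have [q _ pq] := hC; exists (proj1_sig (q x)); first exact: (proj2_sig (q x)).
exact: pq.
Qed.
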